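(* Let $A,B\in\mathbb{C}[X,Y]$ be coprime polynomials with $\deg A,\deg B\le k$, and let $D=A\,\partial_X+B\,\partial_Y$. Let $f/g\in\mathbb{C}(X,Y)\setminus\mathbb{C}$, with $f,g$ coprime, be an indecomposable rational function which is a first integral of $D$, i.e. $D(f/g)=0$. For a generic point $(x,y)\in\mathbb{C}^2$, let $N_D$ be the Newton polygon of the Laurent polynomial $x\,\frac{A(X,Y)}{X}+y\,\frac{B(X,Y)}{Y}$ and let $\mathcal{B}$ be the number of integer points in $N_D\cap\mathbb{N}^2$. Then $$\rho(f,g)<\mathcal{B}+2.$$
   Context: A rational function $h\in\mathbb{C}(X,Y)$ is a (rational) first integral of the derivation $D$ if $D(h)=0$. A rational function $f/g\in\mathbb{C}(X,Y)$ is decomposable if $f/g=u(h)$ with $u\in\mathbb{C}(T)$, $\deg u\ge2$ and $h\in\mathbb{C}(X,Y)$; otherwise it is indecomposable. For coprime $f,g$, $\deg(f/g)=\max\{\deg f,\deg g\}=:d$, and $f^h=Z^{d}f(X/Z,Y/Z)$, $g^h=Z^{d}g(X/Z,Y/Z)\in\mathbb{C}[X,Y,Z]$ are the homogenizations of $f,g$ to degree $d$. The spectrum is $\sigma(f,g)=\{(\lambda:\mu)\in\mathbb{P}^1(\mathbb{C}) : \lambda f^h-\mu g^h \text{ is reducible in } \mathbb{C}[X,Y,Z]\}$ (its elements are called remarkable values). For $(\lambda:\mu)\in\mathbb{P}^1(\mathbb{C})$, let $n(\lambda:\mu)$ be the number of distinct irreducible factors of $\lambda f^h-\mu g^h$ in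 $\mathbb{C}[X,Y,Z]$ (i.e. $\lambda f^h-\mu g^h=\prod_{i=1}^{n(\lambda:\mu)}(f^h_{(\lambda:\mu),i})^{e_{(\lambda:\mu),i}}$ with pairwise non-associate irreducible $f^h_{(\lambda:\mu),i}$). The total order of reducibility is $\rho(f,g)=\sum_{(\lambda:\mu)\in\sigma(f,g)}\big(n(\lambda:\mu)-1\big)$. The Newton polygon of a Laurent polynomial $\sum c_{\alpha,\beta}X^\alpha Y^\beta$ ($(\alpha,\beta)\in\mathbb{Z}^2$) is the convex hull in $\mathbb{R}^2$ of the exponents $(\alpha,\beta)$ with $c_{\alpha,\beta}\neq0$. $\mathbb{N}=\{0,1,2,\dots\}$. *)

(* Defs.v *)
From HB Require Import structures.
From mathcomp Require Import all_boot all_order all_algebra.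
From Stdlib Require Import ClassicalEpsilon.
Set Implicit Arguments. Unset Strict Implicit. Unset Printing Implicit Defensive.
Import Order.TTheory GRing.Theory Num.Theory.
Local Open Scope ring_scope.

Definition asbool (P : Prop) : bool :=
  if excluded_middle_informative P then true else false.

Section Defs.
Variable C : numClosedFieldType.

(* Bivariate polynomials C[X,Y] are {poly {poly C}}: outer variable Y,
   inner variable X.  Coefficient of X^i Y^j: *)
Definition coef2 (p : {poly {poly C}}) (i j : nat) : C := (p`_j)`_i.

(* total degree (0 for the zero polynomial) *)
Definition tdeg (p : {poly {poly C}}) : nat :=
  (\max_(j < size p | (p`_j != 0)%R) ((size (p`_j)%R).-1 + j))%N.

Definition cst2 (c : C) : {poly {poly C}} := c%:P%:P.

Definition dvd2 (d p : {poly {poly C}}) : Prop := exists r, p = r * d.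

Definition coprime2 (p q : {poly {poly C}}) : Prop :=
  forall d, dvd2 d p -> dvd2 d q -> exists2 c : C, c != 0 & d = cst2 c.

Definition dX (p : {poly {poly C}}) : {poly {poly C}} := map_poly (@deriv C) p.
Definition dY (p : {poly {poly C}}) : {poly {poly C}} := deriv p.

Definition derivation (A B p : {poly {poly C}}) : {poly {poly C}} :=
  A * dX p + B * dY p.

Definition const_ratio (f g : {poly {poly C}}) : Prop :=
  exists c : C, f = cst2 c * g.

(* degree of u = a/b (a, b coprime) *)
Definition rdeg (a b : {poly C}) : nat := (maxn (size a) (size b)).-1.

(* q^d * a(p/q) *)
Definition hcomp (d : nat) (a : {poly C}) (p q : {poly {poly C}}) : {poly {poly C}} :=
  \sum_(i < size a) cst2 a`_i * p ^+ i * q ^+ (d - i).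

(* f/g = u(h) with u = a/b in C(T) (a,b coprime), deg u >= 2, h = p/q *)
Definition decomposable (f g : {poly {poly C}}) : Prop :=
  exists (a b : {poly C}) (p q : {poly {poly C}}),
    [/\ coprimep a b, (2 <= rdeg a b)%N, q != 0 &
        f * hcomp (rdeg a b) b p q = g * hcomp (rdeg a b) a p q].

(* Trivariate polynomials C[X,Y,Z] are {poly {poly {poly C}}}: outer Z,
   middle Y, inner X. *)
Definition XX : {poly {poly {poly C}}} := ('X : {poly C})%:P%:P.
Definition YY : {poly {poly {poly C}}} := ('X : {poly {poly C}})%:P.
Definition ZZ : {poly {poly {poly C}}} := 'X.
Definition cst3 (c : C) : {poly {poly {poly C}}} := c%:P%:P%:P.

Definition homog (d : nat) (p : {poly {poly C}}) : {poly {poly {poly C}}} :=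
  \sum_(j < size p) \sum_(i < size p`_j)
     cst3 (coef2 p i j) * XX ^+ i * YY ^+ j * ZZ ^+ (d - (i + j)).

Definition pencil (f g : {poly {poly C}}) (l m : C) : {poly {poly {poly C}}} :=
  let d := maxn (tdeg f) (tdeg g) in
  cst3 l * homog d f - cst3 m * homog d g.

Definition dvd3 (d p : {poly {poly {poly C}}}) : Prop := exists r, p = r * d.
Definition assoc3 (p q : {poly {poly {poly C}}}) : Prop := dvd3 p q /\ dvd3 q p.

Definition irreducible3 (P : {poly {poly {poly C}}}) : Prop :=
  [/\ P != 0, P \isn't a GRing.unit &
      forall Q R, P = Q * R -> Q \is a GRing.unit \/ R \is a GRing.unit].

Definition reducible3 (P : {poly {poly {poly C}}}) : Prop :=
  [/\ P != 0, P \isn't a GRing.unit & ~ irreducible3 P].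

Definition nfactors (P : {poly {poly {poly C}}}) (n : nat) : Prop :=
  exists s : seq {poly {poly {poly C}}},
    [/\ size s = n,
        forall i, (i < n)%N -> irreducible3 (nth 0 s i) /\ dvd3 (nth 0 s i) P,
        forall i j, (i < n)%N -> (j < n)%N -> i <> j ->
                    ~ assoc3 (nth 0 s i) (nth 0 s j) &
        forall Q, irreducible3 Q -> dvd3 Q P ->
                  exists2 i, (i < n)%N & assoc3 Q (nth 0 s i)].

Definition proj_neq (p q : C * C) : Prop := p.1 * q.2 != q.1 * p.2.

(* coefficient of X^(u-1) Y^(v-1) in the Laurent polynomial
   x A(X,Y)/X + y B(X,Y)/Y *)
Definition lcoef (A B : {poly {poly C}}) (x y : C) (u v : nat) : C :=
  x * (if v is v'.+1 then coef2 A u v' else 0)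
  + y * (if u is u'.+1 then coef2 B u' v else 0).

(* all shifted exponents (u,v) of the support lie below this bound *)
Definition nbound (A B : {poly {poly C}}) : nat := (tdeg A + tdeg B).+2.

Definition in_newton (A B : {poly {poly C}}) (x y : C) (a b : int) : Prop :=
  exists w : 'I_(nbound A B) * 'I_(nbound A B) -> rat,
    [/\ forall p, 0 <= w p,
        forall p : 'I_(nbound A B) * 'I_(nbound A B),
          lcoef A B x y p.1 p.2 = 0 -> w p = 0,
        \sum_(p : 'I_(nbound A B) * 'I_(nbound A B)) w p = 1,
        \sum_(p : 'I_(nbound A B) * 'I_(nbound A B)) w p * ((p.1 : nat)%:R - 1) = a%:~R &
        \sum_(p : 'I_(nbound A B) * 'I_(nbound A B)) w p * ((p.2 : nat)%:R - 1) = b%:~R].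

Definition newtonB (A B : {poly {poly C}}) (x y : C) : nat :=
  #|[set p : 'I_(nbound A B) * 'I_(nbound A B) |
       asbool (in_newton A B x y (p.1 : nat)%:Z (p.2 : nat)%:Z)]|.

End Defs.

(* Main.v *)
Require Import Defs.
From HB Require Import structures.
From mathcomp Require Import all_boot all_order all_algebra.
From mathcomp Require Import ring lra zify.
From Stdlib Require Import Classical ClassicalEpsilon.
Set Implicit Arguments. Unset Strict Implicit. Unset Printing Implicit Defensive.
Import Order.TTheory GRing.Theory Num.Theory.
Local Open Scope ring_scope.

(* Every irreducible factor q of a member of the pencil of f and g is a Darboux polynomial:
   D q = L q, and the exponents of the cofactor L lie in the Newton polygon N_D. Keep all factors
   of the pencil members except one for each member and except Z, which divides at most one member.
   If they were more than the lattice points of N_D, their cofactors would satisfy a linear relation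
   \sum_i c_i L_i = 0, so that the closed form w = \sum_i c_i dq_i/q_i would annihilate D. Then
   w = H dlog(p/r) for any two members p and r, with H a first integral. First integrals restrict
   injectively to a line that is not invariant under D, so Lüroth's theorem on the line and the
   indecomposability of f/g make H a rational function of p/r. Hence the residues of w along the
   factors of p are proportional to their multiplicities in p, whereas w has no residue along the
   omitted factor; so all c_i vanish. *)

(** * Unique factorization *)

(** The omitted factors serve twice: they turn n into n - 1, and they supply the contradiction. The
    kept [q_k] and the factor omitted from the same member p both lie over p/r = 0, where H has a
    single value. That value is c_k/e along [q_k], with e the multiplicity of [q_k] in p, and 0
    along the omitted factor. The constant 2 is one unit for Z, which becomes 1 in the affine plane
    where D acts, and one for the strict inequality. Cofactors fit into N_D because D(X^a Y^b) = X^a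
    Y^b (a A/X + b B/Y): the exponents of L q = D q lie in the sum of N_D and the Newton polygon of
    q, and the latter cancels. Genericity of (x, y) keeps every exponent of A/X and B/Y in N_D. The
    restriction to a line turns the field of first integrals into a subfield of C(t), where degrees
    of rational functions are available for Lüroth's argument. On an invariant line a nonzero first
    integral could vanish identically, hence the choice of the line. *)

Section Factorial.
Variable R : idomainType.
Implicit Types p q a b c : R.

Definition dvdr p q := exists r, q = r * p.

Definition primer p := [/\ p != 0, p \isn't a GRing.unit &
  forall a b, dvdr p (a * b) -> dvdr p a \/ dvdr p b].

Definition irredr p := [/\ p != 0, p \isn't a GRing.unit &
  forall a b, p = a * b -> a \is a GRing.unit \/ b \is a GRing.unit].

Definition prime_factored a := exists (u : R) (s : seq R),
  [/\ u \is a GRing.unit, forall p, p \in s -> primer p & a = u * \prod_(p <- s) p].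

Definition factorial := forall a, a != 0 -> prime_factored a.

Lemma dvdr_refl p : dvdr p p.
Proof. by exists 1; rewrite mul1r. Qed.

Lemma dvdr0 p : dvdr p 0.
Proof. by exists 0; rewrite mul0r. Qed.

Lemma dvdr_trans q p r : dvdr p q -> dvdr q r -> dvdr p r.
Proof. by move=> [x ->] [y ->]; exists (y * x); rewrite mulrA. Qed.

Lemma dvdr_mull p q r : dvdr p q -> dvdr p (r * q).
Proof. by move=> [x ->]; exists (r * x); rewrite mulrA. Qed.

Lemma dvdr_mulr p q r : dvdr p q -> dvdr p (q * r).
Proof. by rewrite mulrC; apply: dvdr_mull. Qed.

Lemma dvdr_add p q r : dvdr p q -> dvdr p r -> dvdr p (q + r).
Proof. by move=> [x ->] [y ->]; exists (x + y); rewrite mulrDl. Qed.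

Lemma dvdr_opp p q : dvdr p q -> dvdr p (- q).
Proof. by move=> [x ->]; exists (- x); rewrite mulNr. Qed.

Lemma dvdr_sub p q r : dvdr p q -> dvdr p r -> dvdr p (q - r).
Proof. by move=> h h'; apply: dvdr_add => //; apply: dvdr_opp. Qed.

Lemma dvdr_addl p q r : dvdr p r -> dvdr p (q + r) -> dvdr p q.
Proof. by move=> h h'; rewrite -(addrK r q); apply: dvdr_sub. Qed.

Lemma unitr_neq0 (u : R) : u \is a GRing.unit -> u != 0.
Proof. by apply: contraTneq => ->; rewrite unitr0. Qed.

Lemma dvdr_unit p u : u \is a GRing.unit -> dvdr p u -> p \is a GRing.unit.
Proof. by move=> uu [r er]; move: uu; rewrite er unitrM => /andP[]. Qed.

Lemma primer_ndvd_unit p u : primer p -> u \is a GRing.unit -> ~ dvdr p u.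
Proof. by move=> [_ /negP pu _] uu /(dvdr_unit uu). Qed.

Lemma primer_or p a b : primer p -> dvdr p (a * b) -> dvdr p a \/ dvdr p b.
Proof. by case=> _ _; apply. Qed.

Lemma primer_dvd_mul p a b : primer p -> ~ dvdr p a -> dvdr p (a * b) -> dvdr p b.
Proof. by move=> [_ _ h] na /h[]. Qed.

Lemma primer_dvd_exp p a n : primer p -> dvdr p (a ^+ n) -> dvdr p a.
Proof.
move=> pp; elim: n => [|n IH].
  by rewrite expr0 => h; case: (primer_ndvd_unit pp (unitr1 _) h).
by rewrite exprS => /(primer_or pp)[].
Qed.

Lemma primer_dvd_prod p (s : seq R) : primer p ->
  dvdr p (\prod_(x <- s) x) -> exists2 x, x \in s & dvdr p x.
Proof.
move=> pp; elim: s => [|y s IH].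
  by rewrite big_nil => h; case: (primer_ndvd_unit pp (unitr1 _) h).
rewrite big_cons => /(primer_or pp)[h|/IH[x xs h]].
  by exists y => //; rewrite mem_head.
by exists x => //; rewrite in_cons xs orbT.
Qed.

Lemma primer_irr p : primer p -> irredr p.
Proof.
move=> [p0 pu pp]; split=> // a b e.
case: (pp a b); first by rewrite -e; apply: dvdr_refl.
  move=> [r er]; right; apply/unitrPr; exists r.
  apply: (mulfI p0); rewrite mulr1 {2}e er; ring.
move=> [r er]; left; apply/unitrPr; exists r.
apply: (mulfI p0); rewrite mulr1 {2}e er; ring.
Qed.

Lemma primer_dvd_irr p q : primer p -> irredr q -> dvdr p q -> dvdr q p.
Proof.
move=> [p0 /negP pu _] [_ _ qi] [r er]; case: (qi _ _ er) => // ur.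
by exists r^-1; rewrite er mulKr.
Qed.

Lemma primerMu u p : u \is a GRing.unit -> primer p -> primer (u * p).
Proof.
move=> uu [p0 pu pp]; split; first by rewrite mulf_neq0 // (unitr_neq0 uu).
  by rewrite unitrM uu.
move=> a b [r er]; case: (pp a b) => [|[x ->]|[x ->]]; first by exists (r * u); rewrite er mulrA.
  by left; exists (x / u); rewrite mulrA divrK.
by right; exists (x / u); rewrite mulrA divrK.
Qed.

Lemma irr_primer p : factorial -> irredr p -> primer p.
Proof.
move=> fR ip; have [p0 pu pi] := ip; have [u [s [uu sp e]]] := fR _ p0.
case: s => [|q s] in sp e *; first by move: pu; rewrite e big_nil mulr1 uu.
have pq : primer q by apply: sp; rewrite mem_head.
move: e; rewrite big_cons mulrCA => e.
case: (pi _ _ e) => h; first by case: pq => _ /negP.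
by rewrite e mulrC; apply: primerMu.
Qed.

End Factorial.

Lemma field_factorial (F : fieldType) : factorial F.
Proof.
move=> a a0; exists a, [::]; split => //; first by rewrite unitfE.
by rewrite big_nil mulr1.
Qed.

(** * Gauss's lemma: polynomial rings over factorial rings are factorial *)

Section PolyFactorial.
Variable R : idomainType.
Hypothesis fR : factorial R.
Implicit Types (p c : R) (P Q G S : {poly R}).

Lemma dvdr_polyC p P : dvdr p%:P P <-> forall i, dvdr p P`_i.
Proof.
split=> [[S ->] i|h]; first by exists S`_i; rewrite coefMC.
pose r i := proj1_sig (constructive_indefinite_description _ (h i)).
exists (\poly_(i < size P) r i); apply/polyP => i; rewrite coefMC coef_poly.
case: ltnP => hi; last by rewrite mul0r nth_default.
by rewrite /r; case: constructive_indefinite_description.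
Qed.

Lemma primer_polyC p : primer p -> primer p%:P.
Proof.
move=> pp; have [p0 pu pm] := pp.
split; first by rewrite polyC_eq0.
  by rewrite poly_unitE coefC eqxx (negPf pu) andbF.
move=> a b; move: {2}(size a + size b)%N (leqnn (size a + size b)%N) => n.
elim: n a b => [|n IH] a b.
  rewrite leqn0 addn_eq0 size_poly_eq0 => /andP[/eqP -> _] _; left; exact: dvdr0.
move=> hs hab.
have [->|a0] := eqVneq a 0; first by left; exact: dvdr0.
have [->|b0] := eqVneq b 0; first by right; exact: dvdr0.
have hl : dvdr p (lead_coef a * lead_coef b).
  by rewrite -lead_coefM; apply: (proj1 (dvdr_polyC _ _)).
have dm (P : {poly R}) : dvdr p (lead_coef P) -> dvdr p%:P (lead_coef P *: 'X^((size P).-1)).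
  by move=> [r ->]; exists (r *: 'X^((size P).-1)); rewrite -mul_polyC polyCM -mul_polyC; ring.
have sz (P : {poly R}) : P != 0 -> (size (P - lead_coef P *: 'X^((size P).-1))%R < size P)%N.
  move=> P0; have s0 : (0 < size P)%N by rewrite size_poly_gt0.
  rewrite -[X in (_ < X)%N](prednK s0) ltnS; apply/leq_sizeP => j hj.
  rewrite coefB coefZ coefXn; case: eqP => [->|/eqP hne].
    by rewrite mulr1 subrr.
  rewrite mulr0 subr0 nth_default // -(prednK s0) ltn_neqAle hj andbT eq_sym //.
case: (pm _ _ hl) => h; have hd := dm _ h.
  case: (IH (a - lead_coef a *: 'X^((size a).-1)) b) => [||h1|]; last by right.
  - by rewrite -ltnS; apply: leq_trans hs; rewrite ltn_add2r sz.
  - by rewrite mulrBl; apply: dvdr_sub => //; apply: dvdr_mulr.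
  - by left; rewrite -[a](subrK (lead_coef a *: 'X^((size a).-1))); apply: dvdr_add.
case: (IH a (b - lead_coef b *: 'X^((size b).-1))) => [|||h1]; [| |by left|].
- by rewrite -ltnS; apply: leq_trans hs; rewrite ltn_add2l sz.
- by rewrite mulrBr; apply: dvdr_sub => //; apply: dvdr_mull.
- by right; rewrite -[b](subrK (lead_coef b *: 'X^((size b).-1))); apply: dvdr_add.
Qed.

Definition primitive P := forall p, primer p -> ~ dvdr p%:P P.

Lemma primitive_dvd Q P : dvdr Q P -> primitive P -> primitive Q.
Proof. by move=> h hP p pp hp; apply: (hP p pp); apply: dvdr_trans h. Qed.

Lemma unit_polyC (u : R) : u \is a GRing.unit -> u%:P \is a GRing.unit.
Proof.
by move=> uu; rewrite poly_unitE coefC eqxx uu andbT size_polyC (unitr_neq0 uu).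
Qed.

Lemma primitive_polyC_unit c : c != 0 -> primitive c%:P -> c \is a GRing.unit.
Proof.
move=> c0 pc; have [u [s [uu sp e]]] := fR c0.
case: s => [|q s] in sp e *; first by rewrite e big_nil mulr1.
case: (pc q); first by apply: sp; rewrite mem_head.
by exists (u * \prod_(p <- s) p)%:P; rewrite e big_cons -polyCM mulrAC -mulrA.
Qed.

(** The primes of [c] are cancelled one by one: each divides [S * P] but not the primitive [P],
    hence divides [S]. *)
Lemma gauss_dvdr P G S c : primitive P -> c != 0 -> c%:P * G = S * P -> dvdr P G.
Proof.
move=> hP c0; have [u [s [uu sp ->]]] := fR c0.
elim: s sp S => [|p s IH] sp S.
  rewrite big_nil mulr1 => e; exists ((u^-1)%:P * S).
  by rewrite -mulrA -e mulrA -polyCM mulVr // mul1r.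
rewrite big_cons => e.
have pp : primer p by apply: sp; rewrite mem_head.
have : dvdr p%:P (S * P).
  by rewrite -e; apply: dvdr_mulr; exists (u * \prod_(j <- s) j)%:P; rewrite -polyCM mulrCA mulrC.
case: (primer_polyC pp) => p0 _ h /h[[T eT]|/(hP _ pp)//].
apply: (IH _ T); first by move=> q qs; apply: sp; rewrite in_cons qs orbT.
by apply: (mulfI p0); rewrite mulrA -polyCM [p * _]mulrCA e eT; ring.
Qed.

(** Each constant prime taken out of [P] removes one prime from the factorization of the leading
    coefficient, so the extraction ends. *)
Lemma content P : P != 0 -> exists c P', [/\ c != 0, P = c%:P * P' & primitive P'].
Proof.
move=> P0; have [|u [s]] := fR (_ : lead_coef P != 0); first by rewrite lead_coef_eq0.
 move: {2}(size s) (erefl (size s)) => n; elim: n P P0 u s => [|n IH] P P0 u s hs [uu sp e].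
  exists 1, P; rewrite mul1r; split=> //; first exact: oner_neq0.
  move=> p pp [S eS]; move: e; rewrite (size0nil hs) big_nil mulr1 eS lead_coefM lead_coefC => e.
  by apply: (primer_ndvd_unit pp uu); exists (lead_coef S).
have [hP|] := classic (primitive P).
  by exists 1, P; rewrite mul1r; split=> //; exact: oner_neq0.
move=> nP; have [p [pp [P1 eP]]] : exists p, primer p /\ dvdr p%:P P.
  by apply: NNPP => h; apply: nP => p pp hp; apply: h; exists p.
have P10 : P1 != 0 by apply: contraNneq P0 => h; rewrite eP h mul0r.
have : dvdr p (u * \prod_(x <- s) x) by exists (lead_coef P1); rewrite -e eP lead_coefM lead_coefC.
move/(primer_dvd_mul pp (primer_ndvd_unit pp uu)) => /(primer_dvd_prod pp)[q qs [r er]].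
have [q0 qu qi] := primer_irr (sp _ qs); have [p0 pu _] := pp.
have ur : r \is a GRing.unit by case: (qi _ _ er) => // h; move: pu; rewrite h.
have [||c [P' [c0 eP1 hP']]] := IH P1 P10 (u * r) (rem q s).
- by rewrite size_rem // hs.
- split; [by rewrite unitrM uu|by move=> x /mem_rem/sp|].
  apply: (mulIf p0); have := e; rewrite eP lead_coefM lead_coefC => ->.
  rewrite (perm_big _ (perm_to_rem qs)) big_cons /=.
  by set t := \prod_(_ <- _) _; rewrite er; ring.
by exists (p * c), P'; split=> //; [rewrite mulf_neq0|rewrite eP eP1 polyCM mulrC mulrA].
Qed.

(** [%|] allows a nonzero constant factor on the dividend, so it is divisibility over the fraction
    field; a primitive divisor makes it divisibility in the ring. *)
Lemma gauss_dvdp P G : primitive P -> P %| G -> dvdr P G.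
Proof.
move=> hP /Pdiv.Idomain.dvdpP[[c S] /= c0 e]; apply: (@gauss_dvdr _ _ S c) => //.
by rewrite mul_polyC.
Qed.

Lemma dvdr_dvdp P G : dvdr P G -> P %| G.
Proof. by move=> [S ->]; rewrite dvdp_mull. Qed.

(** The primitive part [g] of the gcd of [P] and [a] divides [P] in the ring. By irreducibility
    either [P] is associate to [g], and divides [a], or [g] is a unit, and [P] is coprime to [a]
    over the fraction field. *)
Lemma primitive_irr_primer P : (1 < size P)%N -> primitive P -> irredr P -> primer P.
Proof.
move=> sP hP [P0 Pu Pi]; split=> // a b hab.
have [g0|g0] := eqVneq (gcdp P a) 0.
  by move: P0; have := dvdp_gcdl P a; rewrite g0 dvd0p => /eqP ->; rewrite eqxx.
have [c [g [c0 eg hg]]] := content g0.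
have gg : g %| gcdp P a by rewrite eg dvdp_mull.
have dP : dvdr g P by apply: (gauss_dvdp hg); exact: dvdp_trans gg (dvdp_gcdl P a).
case: dP => T eT; case: (Pi _ _ eT) => hu.
  left; apply: (gauss_dvdp hP); apply: dvdp_trans (dvdp_gcdr P a).
  rewrite eg eT; move: hu; rewrite poly_unitE => /andP[/size_poly1P[t t0 ->] _].
  by rewrite !mul_polyC dvdpZl // dvdpZr.
right; apply: (gauss_dvdp hP).
have cop : coprimep P a.
  move: hu; rewrite poly_unitE => /andP[/eqP sg _].
  by rewrite coprimep_def eg mul_polyC size_scale ?sg.
by rewrite -(Gauss_dvdpr _ cop); apply: dvdr_dvdp.
Qed.

Lemma prime_factoredM (A : idomainType) (a b : A) :
  prime_factored a -> prime_factored b -> prime_factored (a * b).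
Proof.
move=> [u [s [uu sp ->]]] [v [t [vv tp ->]]]; exists (u * v), (s ++ t).
split; [by rewrite unitrM uu|by move=> x; rewrite mem_cat => /orP[/sp|/tp]|].
by rewrite big_cat /=; ring.
Qed.

Lemma primitive_factored P : P != 0 -> primitive P -> prime_factored P.
Proof.
move: {2}(size P) (leqnn (size P)) => n; elim: n P => [|n IH] P.
  by rewrite leqn0 size_poly_eq0 => ->.
move=> hn P0 hP.
have unitc (Q : {poly R}) : Q != 0 -> primitive Q -> (size Q <= 1)%N -> Q \is a GRing.unit.
  move=> Q0 hQ /size1_polyC eQ; rewrite eQ; apply: unit_polyC.
  by apply: primitive_polyC_unit; [move: Q0; rewrite {1}eQ polyC_eq0|rewrite -eQ].
have [s1|s1] := leqP (size P) 1.
  by exists P, [::]; rewrite big_nil mulr1; split=> //; apply: unitc.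
have Pu : P \isn't a GRing.unit by rewrite poly_unitE; case: eqP s1 => [->|].
have [ip|] := classic (irredr P).
  exists 1, [:: P]; rewrite big_seq1 mul1r unitr1; split=> // p; rewrite inE => /eqP ->.
  exact: primitive_irr_primer.
move=> nip; have [Q [S [e Qu Su]]] : exists Q S, [/\ P = Q * S, Q \isn't a GRing.unit & S \isn't a GRing.unit].
  apply: NNPP => h; apply: nip; split=> // Q S e.
  case: (boolP (Q \is a GRing.unit)) => hQ; first by left.
  case: (boolP (S \is a GRing.unit)) => hS; first by right.
  by case: h; exists Q, S.
have [Q0 S0] : Q != 0 /\ S != 0 by apply/andP; rewrite -negb_or -mulf_eq0 -e.
have hQ : primitive Q by apply: primitive_dvd hP; exists S; rewrite e mulrC.
have hS : primitive S by apply: primitive_dvd hP; exists Q; rewrite e.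
have sQ : (1 < size Q)%N by rewrite ltnNge; apply: contra Qu; apply: unitc.
have sS : (1 < size S)%N by rewrite ltnNge; apply: contra Su; apply: unitc.
have sz : size P = (size Q + size S).-1 by rewrite e size_mul.
by rewrite e; apply: prime_factoredM; apply: IH => //; lia.
Qed.

Lemma poly_factorial : factorial {poly R}.
Proof.
move=> P P0; have [c [P' [c0 eP hP']]] := content P0.
rewrite eP; apply: prime_factoredM; last first.
  by apply: primitive_factored => //; apply: contraNneq P0 => h; rewrite eP h mulr0.
have [u [s [uu sp ->]]] := fR c0; exists u%:P, [seq x%:P | x <- s]; split.
- exact: unit_polyC.
- by move=> p /mapP[x xs ->]; apply: primer_polyC; apply: sp.
- by rewrite polyCM big_map rmorph_prod.
Qed.

End PolyFactorial.

(** * Newton polygons of cofactors *)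

Section SeqMax.
Variables (F : realDomainType) (T : eqType) (f : T -> F).

Lemma seq_argmax (s : seq T) : s != [::] ->
  exists2 m, m \in s & forall x, x \in s -> f x <= f m.
Proof.
elim: s => [//|y [|z s] IH] _.
  by exists y => [|x]; rewrite ?mem_head // inE => /eqP ->.
have [//|m ms hm] := IH; have [h|h] := leP (f m) (f y).
  exists y => [|x]; rewrite ?mem_head // inE => /orP[/eqP -> //|/hm h'].
  exact: le_trans h.
exists m => [|x]; first by rewrite in_cons ms orbT.
by rewrite in_cons => /orP[/eqP ->|/hm//]; exact: ltW.
Qed.

End SeqMax.

Lemma seq_between (F : realFieldType) (L U : seq F) :
  (forall l u, l \in L -> u \in U -> l < u) ->
  exists t, (forall l, l \in L -> l < t) /\ (forall u, u \in U -> t < u).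
Proof.
move=> h; have [->|L0] := eqVneq L [::].
  have [->|U0] := eqVneq U [::]; first by exists 0.
  have [m mU hm] := seq_argmax -%R U0.
  by exists (m - 1); split=> // u /hm; rewrite lerN2 => h'; lra.
have [m mL hm] := seq_argmax id L0.
have [->|U0] := eqVneq U [::].
  by exists (m + 1); split=> // l /hm /= h'; lra.
have [n nU hn] := seq_argmax -%R U0.
have mn := h _ _ mL nU.
exists ((m + n) / 2); split=> [l /hm /= h'|u /hn]; first lra.
by rewrite lerN2 => h'; lra.
Qed.

(** * Gordan's alternative in dimensions one and two *)

Section Gordan.
Variable F : realFieldType.

Lemma gordan1 (I : finType) (S : pred I) (a : I -> F) :
  (exists s, forall i, S i -> 0 < s * a i) \/
  (exists mu : I -> F, [/\ forall i, 0 <= mu i, forall i, ~~ S i -> mu i = 0,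
     0 < \sum_i mu i & \sum_i mu i * a i = 0]).
Proof.
have [/forallP h|] := boolP [forall i, S i ==> (0 < a i)].
  by left; exists 1 => i Si; rewrite mul1r; apply: (implyP (h i)).
rewrite negb_forall => /existsP[i]; rewrite negb_imply -leNgt => /andP[Si ai].
have [/forallP h|] := boolP [forall i, S i ==> (a i < 0)].
  by left; exists (-1) => k Sk; rewrite mulN1r oppr_gt0; apply: (implyP (h k)).
rewrite negb_forall => /existsP[j]; rewrite negb_imply -leNgt => /andP[Sj aj].
(* The weights [a j] at [i] and [- a i] at [j] balance. Both vanish only if [a i = a j = 0], and
   then [b] supplies a positive mass. *)
right; pose b : F := if a j - a i == 0 then 1 else 0.
exists (fun k => (k == i)%:R * (a j + b) + (k == j)%:R * (- a i)).
have sumd (k : I) (g : I -> F) : \sum_l (l == k)%:R * g l = g k.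
  rewrite (bigD1 k) //= eqxx mul1r big1 ?addr0 // => l /negPf ->; exact: mul0r.
have b0 : 0 <= b by rewrite /b; case: eqP.
split.
- by move=> k; apply: addr_ge0; apply: mulr_ge0; rewrite ?ler0n //; lra.
- move=> k nS; have [ek|_] := eqVneq k i; first by rewrite ek Si in nS.
  by have [ek|_] := eqVneq k j; [rewrite ek Sj in nS|rewrite !mul0r addr0].
- by rewrite big_split /= !sumd /b; case: eqP => h; lra.
- under eq_bigr do rewrite mulrDl -!mulrA.
  rewrite big_split /= (sumd i (fun k => (a j + b) * a k)) (sumd j (fun k => - a i * a k)).
  rewrite /b; case: eqP => h; last by ring.
  have [-> ->] : a i = 0 /\ a j = 0 by split; lra.
  ring.
Qed.

(* Fourier-Motzkin elimination of the second coordinate. *)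
Lemma gordan2 (I : finType) (S : pred I) (a b : I -> F) :
  (exists s t, forall i, S i -> 0 < s * a i + t * b i) \/
  (exists mu : I -> F, [/\ forall i, 0 <= mu i, forall i, ~~ S i -> mu i = 0,
     \sum_i mu i = 1, \sum_i mu i * a i = 0 & \sum_i mu i * b i = 0]).
Proof.
(* [inl] keeps the inequalities without [t]; [inr] combines one where [t] has a positive coefficient
   with one where it is negative, so that [t] cancels. *)
pose S' (x : I + I * I) := match x with inl i => S i && (b i == 0)
  | inr p => [&& S p.1, S p.2, 0 < b p.1 & b p.2 < 0] end.
pose a' (x : I + I * I) := match x with inl i => a i
  | inr p => - b p.2 * a p.1 + b p.1 * a p.2 end.
case: (gordan1 S' a') => [[s hs]|[mu [mu0 muS mup mua]]].
  left; exists s.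
  (* [L] and [U] hold the lower and upper bounds imposed on [t]; the inequality of the pair [(i, j)]
     puts the lower bound of [i] below the upper bound of [j]. *)
  pose L := [seq - (s * a i) / b i | i in [pred i | S i && (0 < b i)]].
  pose U := [seq - (s * a i) / b i | i in [pred i | S i && (b i < 0)]].
  have [|t [hl hu]] := @seq_between F L U.
    move=> _ _ /mapP[i] + -> /mapP[j] + ->; rewrite !mem_enum !inE => /andP[Si bi] /andP[Sj bj].
    have := hs (inr (i, j)); rewrite /S' /a' /= Si Sj bi bj => /(_ isT) h.
    rewrite ltr_pdivrMr // mulrAC ltr_ndivlMr //; lra.
  exists t => i Si; case: (ltrgt0P (b i)) => bi.
  - have : - (s * a i) / b i < t by apply: hl; apply/mapP; exists i; rewrite // mem_enum inE Si bi.
    by rewrite ltr_pdivrMr //; lra.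
  - have : t < - (s * a i) / b i by apply: hu; apply/mapP; exists i; rewrite // mem_enum inE Si bi.
    by rewrite ltr_ndivlMr //; lra.
  - have := hs (inl i); rewrite /S' /a' /= Si bi eqxx => /(_ isT); lra.
right.
(* The weight of a pair is shared between its two members with the coefficients that formed the
   pair. *)
pose nu k := mu (inl k) + (\sum_j mu (inr (k, j)) * - b j + \sum_i mu (inr (i, k)) * b i).
have nuE (g : I -> F) : \sum_k nu k * g k =
    \sum_k mu (inl k) * g k + \sum_i \sum_j mu (inr (i, j)) * (- b j * g i + b i * g j).
  rewrite /nu; under eq_bigr do rewrite mulrDl mulrDl.
  rewrite big_split big_split /=; congr (_ + _).
  rewrite (eq_bigr (fun k => \sum_j mu (inr (k, j)) * - b j * g k)); last by move=> k _; rewrite mulr_suml.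
  rewrite [X in _ + X](eq_bigr (fun k => \sum_i mu (inr (i, k)) * b i * g k)); last by move=> k _; rewrite mulr_suml.
  rewrite [X in _ + X]exchange_big -big_split /=; apply: eq_bigr => i _.
  by rewrite -big_split /=; apply: eq_bigr => j _; ring.
have sumE (g : I + I * I -> F) : \sum_x g x = \sum_k g (inl k) + \sum_i \sum_j g (inr (i, j)).
  by rewrite big_sumType /= pair_big_dep /=; congr (_ + _); apply: eq_bigr => -[].
have mur i j : mu (inr (i, j)) != 0 -> [&& S i, S j, 0 < b i & b j < 0].
  by apply: contraNT => h; apply/eqP; apply: muS.
have mul0' i : mu (inl i) != 0 -> S i && (b i == 0).
  by apply: contraNT => h; apply/eqP; apply: muS.
have nu0 k : 0 <= nu k.
  rewrite /nu; apply: addr_ge0 => //; apply: addr_ge0; apply: sumr_ge0 => j _.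
    have [->|/mur/and4P[_ _ _ h]] := eqVneq (mu (inr (k, j))) 0; first by rewrite mul0r.
    by apply: mulr_ge0 => //; lra.
  have [->|/mur/and4P[_ _ h _]] := eqVneq (mu (inr (j, k))) 0; first by rewrite mul0r.
  by apply: mulr_ge0 => //; lra.
have nup : 0 < \sum_k nu k.
  rewrite (eq_bigr (fun k => nu k * 1)); last by move=> k _; rewrite mulr1.
  rewrite nuE; move: mup; rewrite sumE => mup.
  have h1 : 0 <= \sum_k mu (inl k) by apply: sumr_ge0.
  under eq_bigr do rewrite mulr1.
  have h2 i j : 0 <= mu (inr (i, j)) * (- b j * 1 + b i * 1).
    have [->|/mur/and4P[_ _ h h']] := eqVneq (mu (inr (i, j))) 0; first by rewrite mul0r.
    by apply: mulr_ge0 => //; lra.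
  rewrite lt_neqAle addr_ge0 ?andbT //; last by apply: sumr_ge0 => i _; apply: sumr_ge0.
  apply: contraTneq mup => /esym/eqP; rewrite paddr_eq0 //; last by apply: sumr_ge0 => i _; apply: sumr_ge0.
  move=> /andP[/eqP -> /eqP h3]; rewrite add0r -leNgt big1 // => i _; rewrite big1 // => j _.
  apply/eqP/contraT => hm; have /and4P[_ _ hb hb'] := mur _ _ hm.
  have e1 : \sum_j mu (inr (i, j)) * (- b j * 1 + b i * 1) = 0.
    by apply: psumr_eq0P h3 _ _ => // i' _; apply: sumr_ge0.
  have /eqP : mu (inr (i, j)) * (- b j * 1 + b i * 1) = 0 by apply: psumr_eq0P e1 _ _.
  rewrite mulf_eq0 (negPf hm) /=.
  by move=> /eqP; lra.
exists (fun k => nu k / \sum_k nu k); split.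
- by move=> i; rewrite divr_ge0 // ltW.
- move=> k nS; suff -> : nu k = 0 by rewrite mul0r.
  rewrite /nu muS; last by rewrite /= (negPf nS).
  rewrite add0r !big1 ?addr0 // => j _; rewrite muS ?mul0r //=; first by rewrite (negPf nS) andbF.
  by rewrite (negPf nS).
- by rewrite -mulr_suml divff // gt_eqF.
- under eq_bigr do rewrite mulrAC; rewrite -mulr_suml nuE; move: mua; rewrite sumE /= => ->; exact: mul0r.
- under eq_bigr do rewrite mulrAC; rewrite -mulr_suml nuE big1 ?add0r; last first.
    move=> k _; have [->|/mul0'/andP[_ /eqP ->]] := eqVneq (mu (inl k)) 0; [exact: mul0r|exact: mulr0].
  rewrite big1 ?mul0r // => i _; rewrite big1 // => j _; ring.
Qed.

End Gordan.

(** * Weights of monomials and the exponents of cofactors *)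

Section Newton.
Variable C : numClosedFieldType.
Local Notation R := {poly {poly C}}.
Implicit Types (p q A B L : R).

Lemma coef2_tdeg p i j : coef2 p i j != 0 -> (i + j <= tdeg p)%N.
Proof.
rewrite /coef2 /tdeg => h.
have pj : p`_j != 0 by apply: contraNneq h => ->; rewrite coef0.
have hj : (j < size p)%N by rewrite ltnNge; apply: contra pj => /(nth_default 0) ->.
have hi : (i < size (p`_j)%R)%N by rewrite ltnNge; apply: contra h => /(nth_default 0) ->.
apply: leq_trans (leq_bigmax_cond (Ordinal hj) pj); rewrite /= leq_add2r.
by rewrite -ltnS (leq_trans hi) // leqSpred.
Qed.

Lemma coef2M p q m n : coef2 (p * q) m n =
  \sum_(b < n.+1) \sum_(a < m.+1) coef2 p a b * coef2 q (m - a) (n - b).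
Proof. by rewrite /coef2 coefM coef_sum; apply: eq_bigr => b _; rewrite coefM. Qed.

Lemma poly2P p q : (forall i j, coef2 p i j = coef2 q i j) -> p = q.
Proof. by move=> h; apply/polyP => j; apply/polyP => i; apply: h. Qed.

Lemma coef2_neq0 p : p != 0 -> exists i j, coef2 p i j != 0.
Proof.
move=> p0; exists (size p`_(size p).-1).-1, (size p).-1.
by rewrite /coef2 -/(lead_coef _) lead_coef_eq0 -/(lead_coef _) lead_coef_eq0.
Qed.

Lemma coef2M_neq0 p q m n : coef2 (p * q) m n != 0 ->
  exists a b c d, [/\ (a + c = m)%N, (b + d = n)%N, coef2 p a b != 0 & coef2 q c d != 0].
Proof.
rewrite coef2M => h; apply: NNPP => h'; move/eqP: h; apply.
rewrite big1 // => b _; rewrite big1 // => a _; apply/eqP/contraT.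
rewrite mulf_eq0 negb_or => /andP[h1 h2]; case: h'.
by exists a, b, (m - a)%N, (n - b)%N; split=> //; rewrite subnKC // -ltnS ltn_ord.
Qed.

Section Weight.
Variables w1 w2 : rat.

Definition wt (i j : nat) : rat := w1 * i%:R + w2 * j%:R.

Lemma wtD a b c d : wt (a + c) (b + d) = wt a b + wt c d.
Proof. by rewrite /wt !natrD; ring. Qed.

Definition wt_part (M : rat) p : R :=
  \poly_(j < size p) \poly_(i < size p`_j) (if wt i j == M then coef2 p i j else 0).

Lemma coef2_wt_part M p i j :
  coef2 (wt_part M p) i j = if wt i j == M then coef2 p i j else 0.
Proof.
rewrite /coef2 /wt_part coef_poly; case: ltnP => hj; last first.
  by rewrite (nth_default _ hj) coef0; case: ifP.
rewrite coef_poly; case: ltnP => // hi.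
by rewrite nth_default //; case: ifP.
Qed.

Lemma wt_max p : p != 0 -> exists i j, coef2 p i j != 0 /\
  forall i' j', coef2 p i' j' != 0 -> wt i' j' <= wt i j.
Proof.
move=> p0; have [a [b hab]] := coef2_neq0 p0.
pose T := (tdeg p).+1.
pose s := [seq x <- allpairs pair (iota 0 T) (iota 0 T) | coef2 p x.1 x.2 != 0].
have hs i j : coef2 p i j != 0 -> (i, j) \in s.
  move=> h; rewrite mem_filter; apply/andP; split=> //; apply/allpairsP; exists (i, j).
  by have := coef2_tdeg h; rewrite !mem_iota /T; split=> //=; lia.
have s0 : s != [::] by apply: contraTneq (hs _ _ hab) => ->.
have [[i j] + hm] := seq_argmax (fun x => wt x.1 x.2) s0.
rewrite mem_filter => /andP[/= h _]; exists i, j; split=> // i' j' /hs; exact: hm.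
Qed.

(* The parts of maximal weight multiply without cancellation, as R is a domain. *)
Lemma wt_top_mul p q i j k l :
  coef2 p i j != 0 -> (forall i' j', coef2 p i' j' != 0 -> wt i' j' <= wt i j) ->
  coef2 q k l != 0 -> (forall i' j', coef2 q i' j' != 0 -> wt i' j' <= wt k l) ->
  exists m n, wt m n = wt i j + wt k l /\ coef2 (p * q) m n != 0.
Proof.
move=> pij pm qkl qm.
have nz r a b : coef2 r a b != 0 -> wt_part (wt a b) r != 0.
  by apply: contraNneq => h; have := coef2_wt_part (wt a b) r a b; rewrite h eqxx /coef2 !coef0 => <-.
have [m [n hmn]] := coef2_neq0 (mulf_neq0 (nz _ _ _ pij) (nz _ _ _ qkl)).
have emn : wt m n = wt i j + wt k l.
  have [a [b [c [d [<- <-]]]]] := coef2M_neq0 hmn; rewrite !coef2_wt_part wtD.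
  have [->|_] := eqVneq (wt a b) (wt i j); last by rewrite eqxx.
  by have [->|_] := eqVneq (wt c d) (wt k l); last by rewrite eqxx.
exists m, n; split=> //; apply: contraNneq hmn => h; rewrite -h !coef2M.
apply/eqP; apply: eq_bigr => b _; apply: eq_bigr => a _; rewrite !coef2_wt_part.
have ha : wt m n = wt a b + wt (m - a) (n - b).
  by rewrite -wtD !subnKC // -ltnS ltn_ord.
have [e|pab] := eqVneq (coef2 p a b) 0; first by rewrite e; case: ifP => _; rewrite !mul0r.
have [e|qab] := eqVneq (coef2 q (m - a) (n - b)) 0.
  by rewrite e; do 2 case: ifP => _; rewrite !(mulr0, mul0r).
have := pm _ _ pab; have := qm _ _ qab; rewrite emn in ha => h1 h2.
have -> : wt a b = wt i j by lra.
have -> : wt (m - a) (n - b) = wt k l by lra.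
by rewrite !eqxx.
Qed.

End Weight.

Lemma coef2_dX p i j : coef2 (dX p) i j = coef2 p i.+1 j *+ i.+1.
Proof. by rewrite /coef2 /dX coef_map_id0 ?deriv0 // coef_deriv. Qed.

Lemma coef2_dY p i j : coef2 (dY p) i j = coef2 p i j.+1 *+ j.+1.
Proof. by rewrite /coef2 /dY coef_deriv coefMn. Qed.

Lemma coef2D p q i j : coef2 (p + q) i j = coef2 p i j + coef2 q i j.
Proof. by rewrite /coef2 !coefD. Qed.

(* No cancellation between the two terms of the Laurent polynomial. *)
Definition lgeneric A B (x y : C) := forall u v : nat, lcoef A B x y u v = 0 ->
  (forall v', v = v'.+1 -> coef2 A u v' = 0) /\ (forall u', u = u'.+1 -> coef2 B u' v = 0).

(** If [(a, b)] were outside the polygon, some linear weight would be larger at [(a, b)] than on all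
    of N_D. The top weight of [L * q] would then exceed every sum of a weight on N_D and a weight of
    an exponent of [q], but each term of D q has such a sum as its weight. *)
Lemma cofactor_newton A B q L x y a b : lgeneric A B x y -> q != 0 ->
  derivation A B q = L * q -> coef2 L a b != 0 -> in_newton A B x y a%:Z b%:Z.
Proof.
move=> gen q0 eD hL.
pose N := nbound A B.
pose S (p : 'I_N * 'I_N) := lcoef A B x y p.1 p.2 != 0.
case: (gordan2 S (fun p : 'I_N * 'I_N => (p.1 : nat)%:R - 1 - a%:R : rat)
  (fun p : 'I_N * 'I_N => (p.2 : nat)%:R - 1 - b%:R)).
  move=> [w1' [w2' hw]]; pose w1 := - w1'; pose w2 := - w2'.
  have L0 : L != 0 by apply: contraNneq hL => ->; rewrite /coef2 !coef0.
  have [i [j [Lij Lm]]] := wt_max w1 w2 L0.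
  have [k [l [qkl qm]]] := wt_max w1 w2 q0.
  have [m [n [emn]]] := wt_top_mul Lij Lm qkl qm.
  have hab := Lm _ _ hL.
  have key u v c d : (u < N)%N -> (v < N)%N -> lcoef A B x y u v != 0 ->
      coef2 q c d != 0 -> (u + c = m.+1)%N -> (v + d = n.+1)%N -> False.
    move=> hu hv huv qcd eu ev.
    have := hw (Ordinal hu, Ordinal hv) huv; have := qm _ _ qcd.
    have := congr1 (fun z => z%:R : rat) eu; have := congr1 (fun z => z%:R : rat) ev.
    move: hab emn; rewrite /wt /w1 /w2 /= -!natr1 !natrD.
    move=> h1 h2 h3 h4 h5 h6.
    have e1 : m%:R = u%:R + c%:R - 1 :> rat by clear -h4; lra.
    have e2 : n%:R = v%:R + d%:R - 1 :> rat by clear -h3; lra.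
    by rewrite e1 e2 in h2; clear -h1 h2 h5 h6; lra.
  rewrite -eD /derivation coef2D.
  have [->|hA] := eqVneq (coef2 (A * dX q) m n) 0; last first.
    move=> _; have [c [d [e [g [em en hc]]]]] := coef2M_neq0 hA.
    rewrite coef2_dX mulrn_eq0 negb_or /= => he.
    have cd := coef2_tdeg hc.
    (* [lcoef] shifts both exponents by one: the term X^c Y^d of [A] contributes X^(c-1) Y^d to A/X,
       found at [(c, d.+1)]. *)
    case: (@key c d.+1 e.+1 g); rewrite /N /nbound //; try lia.
    by apply: contraNneq hc => /gen[/(_ d erefl) -> _].
  rewrite add0r => hB; have [c [d [e [g [em en hc]]]]] := coef2M_neq0 hB.
  rewrite coef2_dY mulrn_eq0 negb_or /= => he.
  have cd := coef2_tdeg hc.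
  case: (@key c.+1 d e g.+1); rewrite /N /nbound //; try lia.
  by apply: contraNneq hc => /gen[_ /(_ c erefl) ->].
(* In the other alternative [mu] is itself the convex combination that [in_newton] asks for. *)
move=> [mu [mu0 muS mu1 mua mub]]; exists mu; split=> //.
- by move=> p hp; apply: muS; rewrite /S hp eqxx.
- move: mua; under eq_bigr do rewrite mulrBr; rewrite sumrB -mulr_suml mu1 mul1r => /eqP.
  by rewrite subr_eq0 => /eqP.
- move: mub; under eq_bigr do rewrite mulrBr; rewrite sumrB -mulr_suml mu1 mul1r => /eqP.
  by rewrite subr_eq0 => /eqP.
Qed.

(** [newtonB] searches only coordinates below [nbound]; no lattice point of the polygon with natural
    coordinates is lost by this. *)
Lemma in_newton_bound A B x y (a b : nat) : in_newton A B x y a%:Z b%:Z ->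
  (a < nbound A B)%N /\ (b < nbound A B)%N.
Proof.
move=> [w [w0 _ w1 ha hb]].
have bd (c : 'I_(nbound A B) * 'I_(nbound A B) -> 'I_(nbound A B)) (d : nat) :
    \sum_p w p * ((c p : nat)%:R - 1) = d%:~R -> (d < nbound A B)%N.
  move=> h; rewrite -(ltr_nat rat); change (d%:R < (nbound A B)%:R :> rat).
  have -> : (d%:R : rat) = d%:~R by [].
  rewrite -h; apply: (@le_lt_trans _ _ (\sum_p w p * ((nbound A B)%:R - 1))).
    apply: ler_sum => p _; apply: ler_wpM2l => //; rewrite lerD2r ler_nat.
    exact: ltnW (ltn_ord _).
  by rewrite -mulr_suml w1 mul1r ltrBlDr ltrDl ltr01.
by split; [apply: (bd fst)|apply: (bd snd)].
Qed.

(** Each coefficient of the Laurent polynomial is a linear form in x and y. [Delta] is the product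
    of those forms that are not identically zero. *)
Lemma lgeneric_exists A B : exists2 Delta : R, Delta != 0 &
  forall x y : C, (Delta.[y%:P]).[x] != 0 -> lgeneric A B x y.
Proof.
pose N := nbound A B.
pose ca (p : 'I_N * 'I_N) := if p.2 : nat is v'.+1 then coef2 A p.1 v' else 0.
pose cb (p : 'I_N * 'I_N) := if p.1 : nat is u'.+1 then coef2 B u' p.2 else 0.
pose lin (p : 'I_N * 'I_N) : R := (ca p *: 'X)%:P + (cb p)%:P *: 'X.
pose D0 := \prod_(p : 'I_N * 'I_N | (ca p != 0) || (cb p != 0)) lin p.
have evl (p : 'I_N * 'I_N) x y : ((lin p).[y%:P]).[x] = x * ca p + y * cb p.
  by rewrite /lin !hornerE /=; ring.
exists D0.
  rewrite /D0; apply/prodf_neq0 => p; apply: contraTneq => h.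
  have hb : cb p = 0.
    by have := evl p 0 1; rewrite h !horner0; move/esym; rewrite mul0r add0r mul1r.
  have ha : ca p = 0.
    by have := evl p 1 0; rewrite h !horner0; move/esym; rewrite mul0r addr0 mul1r.
  by rewrite ha hb eqxx.
move=> x y; rewrite /D0 horner_prod horner_prod => hprod u v huv.
have [hu|hu] := ltnP u N; last first.
  split=> [v' _|u' eu]; apply/eqP/contraT => /coef2_tdeg; rewrite /N /nbound in hu; lia.
have [hv|hv] := ltnP v N; last first.
  split=> [v' ev|u' _]; apply/eqP/contraT => /coef2_tdeg; rewrite /N /nbound in hv; lia.
pose p := (Ordinal hu, Ordinal hv).
have : ~~ ((ca p != 0) || (cb p != 0)).
  apply/negP => hp; move/prodf_neq0/(_ p hp): hprod; rewrite evl.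
  by move: huv; rewrite /lcoef /ca /cb /= => ->; rewrite eqxx.
rewrite negb_or !negbK => /andP[/eqP ha /eqP hb]; split.
  by move=> v' ev; move: ha; rewrite /ca /p /= ev.
by move=> u' eu; move: hb; rewrite /cb /p /= eu.
Qed.

(** The cofactors live in the span of [newtonB A B x y] monomials, so a coefficient matrix with more
    rows than that has a nonzero left kernel. *)
Lemma cofactor_dependent A B x y (N : nat) (q L : 'I_N -> R) :
  lgeneric A B x y -> (forall i, q i != 0) ->
  (forall i, derivation A B (q i) = L i * q i) -> (newtonB A B x y < N)%N ->
  exists c : 'I_N -> C, (exists i, c i != 0) /\ \sum_i cst2 (c i) * L i = 0.
Proof.
move=> gen q0 eD hN.
pose T := [set p : 'I_(nbound A B) * 'I_(nbound A B) |
       asbool (in_newton A B x y (p.1 : nat)%:Z (p.2 : nat)%:Z)].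
pose e (k : 'I_#|T|) : 'I_(nbound A B) * 'I_(nbound A B) := @enum_val _ (mem T) k.
pose M : 'M[C]_(N, #|T|) := \matrix_(i, k) coef2 (L i) (e k).1 (e k).2.
have kn : kermx M != 0.
  by rewrite -mxrank_eq0 mxrank_ker -lt0n subn_gt0; apply: leq_ltn_trans hN; apply: rank_leq_col.
have [c hc c0] := rowV0Pn (kn : kermx M != 0).
exists (fun i => c 0 i); split.
  apply: NNPP => h; move/eqP: c0; apply; apply/rowP => i; rewrite mxE.
  by apply/eqP/contraT => hi; case: h; exists i.
apply: poly2P => a b; rewrite /coef2 coef_sum coef_sum !coef0.
have -> : \sum_(i < N) (cst2 (c 0 i) * L i)`_b`_a = \sum_i c 0 i * coef2 (L i) a b.
  by apply: eq_bigr => i _; rewrite /cst2 coefCM coefCM.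
have [h|h] := classic (in_newton A B x y a%:Z b%:Z); last first.
  rewrite big1 // => i _; have [->|hi] := eqVneq (coef2 (L i) a b) 0; first exact: mulr0.
  by case: h; apply: cofactor_newton gen (q0 i) (eD i) hi.
have [ha hb] := in_newton_bound h.
have hT : (Ordinal ha, Ordinal hb) \in T.
  by rewrite inE /asbool /=; case: excluded_middle_informative.
move/sub_kermxP/rowP: hc => /(_ (enum_rank_in hT (Ordinal ha, Ordinal hb))).
rewrite mxE [RHS]mxE => h0; rewrite -[RHS]h0; apply: eq_bigr => i _.
by rewrite mxE /e enum_rankK_in.
Qed.

End Newton.

(** * First integrals and their restriction to a line *)

Section Derivations.
Variable C : numClosedFieldType.
Local Notation R := {poly {poly C}}.
Implicit Types (p q r : R).

Definition is_deriv (D : R -> R) := [/\ forall p q, D (p + q) = D p + D q,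
  forall p q, D (p * q) = D p * q + p * D q & forall c, D (cst2 c) = 0].

Lemma cst2D (a b : C) : cst2 (a + b) = cst2 a + cst2 b.
Proof. by rewrite /cst2 !polyCD. Qed.

Lemma cst2M (a b : C) : cst2 (a * b) = cst2 a * cst2 b.
Proof. by rewrite /cst2 !polyCM. Qed.

Lemma cst2N (a : C) : cst2 (- a) = - cst2 a.
Proof. by rewrite /cst2 !polyCN. Qed.

Lemma cst2_eq0 (a : C) : (cst2 a == 0) = (a == 0).
Proof. by rewrite /cst2 !polyC_eq0. Qed.

Lemma cst20 : cst2 (0 : C) = 0. Proof. by rewrite /cst2 !polyC0. Qed.

Lemma cst21 : cst2 (1 : C) = 1. Proof. by rewrite /cst2 !polyC1. Qed.

Lemma dX_deriv : is_deriv (@dX C).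
Proof.
split=> [p q|p q|c].
- by apply: poly2P => i j; rewrite !(coef2D, coef2_dX) mulrnDl.
- apply/polyP => j; rewrite /dX coefD !coefM coef_map_id0 ?deriv0 //.
  rewrite coefM raddf_sum -big_split /=; apply: eq_bigr => k _.
  by rewrite derivM !coef_map_id0 ?deriv0.
- by rewrite /dX /cst2 map_polyE polyseqC; apply/polyP => j; rewrite coef_Poly coef0;
    case: eqP => _; case: j => [|j] /=; rewrite ?nth_nil ?derivC.
Qed.

Lemma dY_deriv : is_deriv (@dY C).
Proof. by split=> [p q|p q|c]; rewrite /dY ?derivD ?derivM ?derivC. Qed.

Lemma derivation_deriv A B : is_deriv (derivation A B).
Proof.
have [xa xm xc] := dX_deriv; have [ya ym yc] := dY_deriv.
split=> [p q|p q|c]; rewrite /derivation ?xa ?ya ?xm ?ym ?xc ?yc; ring.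
Qed.

Lemma dXY p : dX (dY p) = dY (dX p).
Proof.
apply: poly2P => i j; rewrite coef2_dX !coef2_dY coef2_dX.
by rewrite -!mulrnA mulnC.
Qed.

Variable D : R -> R.
Hypothesis hD : is_deriv D.

Lemma derD p q : D (p + q) = D p + D q. Proof. by case: hD. Qed.
Lemma derM p q : D (p * q) = D p * q + p * D q. Proof. by case: hD. Qed.
Lemma derC c : D (cst2 c) = 0. Proof. by case: hD. Qed.
Lemma der0 : D 0 = 0. Proof. by rewrite -cst20 derC. Qed.
Lemma der1 : D 1 = 0. Proof. by rewrite -cst21 derC. Qed.
Lemma derN p : D (- p) = - D p.
Proof. by apply/eqP; rewrite -addr_eq0 -derD addNr der0. Qed.
Lemma derB p q : D (p - q) = D p - D q. Proof. by rewrite derD derN. Qed.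

(** The extra factor [p] avoids the exponent [n - 1] and so includes [n = 0]. *)
Lemma derX p n : p * D (p ^+ n) = n%:R * p ^+ n * D p.
Proof.
elim: n => [|n IH]; first by rewrite expr0 der1 mulr0 !mul0r.
rewrite exprS derM mulrDr [p * (p * _)]mulrCA IH -[n.+1]addn1 natrD; ring.
Qed.

Definition first_int p q := q * D p = p * D q.

Definition nonconst p q := forall c, p <> cst2 c * q.

Lemma FI0 q : first_int 0 q.
Proof. by rewrite /first_int der0 mulr0 mul0r. Qed.

Lemma FI_sym p q : first_int p q -> first_int q p.
Proof. by rewrite /first_int. Qed.

Lemma FIB x y w : first_int x w -> first_int y w -> first_int (x - y) w.
Proof. by rewrite /first_int derB => h h'; rewrite mulrBr h h'; ring. Qed.

Lemma FIM x y w v : first_int x w -> first_int y v -> first_int (x * y) (w * v).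
Proof.
rewrite /first_int !derM => h h'.
have -> : w * v * (D x * y + x * D y) = (w * D x) * v * y + w * x * (v * D y) by ring.
by rewrite h h'; ring.
Qed.

Lemma FIMl x w v : first_int x w -> first_int (v * x) (v * w).
Proof. by apply: FIM; rewrite /first_int. Qed.

Lemma FIC c x w : first_int x w -> first_int (cst2 c * x) w.
Proof. by rewrite /first_int derM derC mul0r add0r => h; rewrite mulrCA h mulrA. Qed.

Lemma FI_refl x : first_int x x. Proof. by []. Qed.

Lemma FI_trans x y w : w != 0 -> first_int x w -> first_int y w -> first_int x y.
Proof.
rewrite /first_int => w0 h h'; apply: (mulfI w0).
by rewrite mulrCA h [RHS]mulrCA h'; ring.
Qed.

Lemma FI_cancel x y w : w != 0 -> first_int (x * w) (y * w) -> first_int x y.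
Proof.
rewrite /first_int !derM => w0 h; apply: (mulfI w0); apply: (mulfI w0).
by move/eqP: h; rewrite -subr_eq0 => /eqP h; apply/eqP; rewrite -subr_eq0 -h; apply/eqP; ring.
Qed.

Section Line.
Variables s y0 : C.
(** The line Y = y0 + s X is parametrized by X: [ell] is its equation, [ev] the restriction to it,
    and [hell] says that D does not leave it invariant. *)
Let c0 : {poly C} := y0%:P + s *: 'X.
Let ell : R := 'X - c0%:P.
Local Notation ev p := (p : R).[c0].
Hypothesis hell : ev (D ell) != 0.

Lemma ell_neq0 : ell != 0. Proof. by rewrite polyXsubC_eq0. Qed.

Lemma ev_cst2 c : ev (cst2 c) = c%:P. Proof. by rewrite /cst2 hornerC. Qed.

Lemma ell_mult p : p != 0 -> exists a p', p = p' * ell ^+ a /\ ev p' != 0.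
Proof.
move=> p0; have [a [p' hp ->]] := multiplicity_XsubC p c0.
by exists a, p'; split=> //; move: hp; rewrite p0.
Qed.

(* The line is not invariant under D, so a first integral has neither zero nor pole along it. *)
Lemma FI_mult p q a b : first_int (p * ell ^+ a) (q * ell ^+ b) ->
  ev p != 0 -> ev q != 0 -> a = b.
Proof.
move=> h hp hq.
have e : q * (ell * D p + a%:R * p * D ell) = p * (ell * D q + b%:R * q * D ell).
  have l0 : ell ^+ (a + b) != 0 by rewrite expf_neq0 // ell_neq0.
  apply: (mulfI l0); move: h; rewrite /first_int !derM => /(congr1 (fun z => ell * z)).
  have -> : ell * (q * ell ^+ b * (D p * ell ^+ a + p * D (ell ^+ a))) =
    q * ell ^+ b * (ell * D p * ell ^+ a + p * (ell * D (ell ^+ a))) by ring.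
  have -> : ell * (p * ell ^+ a * (D q * ell ^+ b + q * D (ell ^+ b))) =
    p * ell ^+ a * (ell * D q * ell ^+ b + q * (ell * D (ell ^+ b))) by ring.
  rewrite !derX exprD => e.
  have -> : ell ^+ a * ell ^+ b * (q * (ell * D p + a%:R * p * D ell)) =
    q * ell ^+ b * (ell * D p * ell ^+ a + p * (a%:R * ell ^+ a * D ell)) by ring.
  by rewrite e; ring.
(* On the line [ell] vanishes, and the identity reduces to a p q D(ell) = b p q D(ell), where p, q
   and D(ell) restrict to nonzero polynomials. *)
move/(congr1 (fun z => ev z)): e; rewrite !hornerM !hornerD !hornerM.
have -> : ev ell = 0 by rewrite /ell !hornerE subrr.
rewrite !mul0r !add0r => /eqP; rewrite -subr_eq0.
have -> : ev q * (ev (a%:R) * ev p * ev (D ell)) - ev p * (ev (b%:R) * ev q * ev (D ell)) =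
  (ev (a%:R) - ev (b%:R)) * (ev p * ev q * ev (D ell)) by ring.
rewrite mulf_eq0 !(negPf (mulf_neq0 _ _)) ?mulf_neq0 // orbF subr_eq0.
have evn n : (ev (n%:R)).[0] = n%:R.
  by rewrite [ev _](rmorph_nat (horner_eval c0) n); apply: (rmorph_nat (horner_eval 0) n).
by move/eqP/(congr1 (horner^~ 0)); rewrite !evn => /eqP; rewrite eqr_nat => /eqP.
Qed.

Lemma FI_ev p q : first_int p q -> p != 0 -> ev q != 0 -> ev p != 0.
Proof.
move=> h p0 hq; have [a [p' [ep hp']]] := ell_mult p0.
have : first_int (p' * ell ^+ a) (q * ell ^+ 0) by rewrite expr0 mulr1 -ep.
by move/FI_mult => /(_ hp' hq) a0; rewrite ep a0 expr0 mulr1.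
Qed.

(** Injectivity of the restriction: [(p - cst2 c * q) / q] is a first integral that vanishes on the
    line. *)
Lemma FI_const p q c : first_int p q -> ev q != 0 -> ev p = c%:P * ev q -> p = cst2 c * q.
Proof.
move=> h hq e; apply/eqP; rewrite -subr_eq0; apply/contraT => n0.
have h' : first_int (p - cst2 c * q) q by apply: FIB => //; apply: FIC.
by have := FI_ev h' n0 hq; rewrite hornerD hornerN hornerM ev_cst2 e subrr eqxx.
Qed.

(* G/w is a polynomial over the field of first integrals whose restriction to the line, with
   parameter t = 'X, has the root t. *)
Definition vanishing (G : {poly R}) := exists w, [/\ ev w != 0,
  forall j, first_int G`_j w & (map_poly (horner_eval c0) G).['X] = 0].

Lemma vanishing_lead G : vanishing G -> G != 0 -> ev (lead_coef G) != 0.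
Proof. by move=> [w [w0 hw _]] G0; apply: FI_ev (hw _) _ w0; rewrite lead_coef_eq0. Qed.

(** One step of the division of [P] by [G], with leading coefficients cross-multiplied instead of
    inverted. *)
Definition cancel_lead (G P : {poly R}) : {poly R} :=
  (lead_coef G)%:P * P - (lead_coef P)%:P * ('X^(size P - size G) * G).

Lemma vanishing_cancel G P : vanishing G -> vanishing P -> vanishing (cancel_lead G P).
Proof.
move=> [w [w0 hw ew]] [v [v0 hv e_v]]; exists (w * v); split.
- by rewrite hornerM mulf_neq0.
- move=> j; rewrite coefB !coefCM coefXnM.
  apply: FIB; first by apply: FIM; [apply: hw|apply: hv].
  rewrite mulrC; case: ltnP => _; last by apply: FIM; [apply: hw|apply: hv].
  by rewrite mul0r; apply: FI0.
- by rewrite /cancel_lead rmorphB !rmorphM hornerD hornerN !hornerM ew e_v !mulr0 subr0.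
Qed.

Lemma size_cancel (G P : {poly R}) : G != 0 -> P != 0 -> (size G <= size P)%N ->
  (size (cancel_lead G P) < size P)%N.
Proof.
move=> G0 P0 hs; have sP : (0 < size P)%N by rewrite size_poly_gt0.
have sG : (0 < size G)%N by rewrite size_poly_gt0.
rewrite -[X in (_ < X)%N](prednK sP) ltnS; apply/leq_sizeP => j hj.
have hk : (size P - size G <= j)%N by apply: leq_trans hj; lia.
rewrite /cancel_lead coefB !coefCM coefXnM ltnNge hk /=.
move: hj; rewrite leq_eqVlt => /orP[/eqP <-|hj]; last first.
  have [h1 h2] : (size P <= j)%N /\ (size G <= j - (size P - size G))%N by split; lia.
  by rewrite (nth_default _ h1) (nth_default _ h2) !mulr0 subrr.
rewrite (_ : ((size P).-1 - (size P - size G))%N = (size G).-1); last by lia.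
by rewrite -!lead_coefE mulrC subrr.
Qed.

(** Division steps stay among the vanishing polynomials, so by minimality the remainder is 0. The
    second divisibility does not follow from the first, whose multiplier might vanish on the line;
    the multipliers used here are powers of [lead_coef G], which does not. *)
Lemma vanishing_min_dvd G : vanishing G -> G != 0 ->
  (forall P, vanishing P -> P != 0 -> (size G <= size P)%N) ->
  forall P, vanishing P -> G %| P /\ map_poly (horner_eval c0) G %| map_poly (horner_eval c0) P.
Proof.
move=> vG G0 Gmin P; move: {2}(size P) (leqnn (size P)) => n.
elim: n P => [|n IH] P.
  by rewrite leqn0 size_poly_eq0 => /eqP -> _; rewrite rmorph0 !dvdp0.
move=> hs vP; have [->|P0] := eqVneq P 0; first by rewrite rmorph0 !dvdp0.
have hGP := Gmin _ vP P0.
have [|h1 h2] := IH (cancel_lead G P) _ (vanishing_cancel vG vP).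
  by rewrite -ltnS; apply: leq_trans hs; apply: size_cancel.
have e : (lead_coef G)%:P * P = cancel_lead G P + (lead_coef P)%:P * 'X^(size P - size G) * G.
  by rewrite /cancel_lead -mulrA subrK.
split.
  by rewrite -(@dvdpZr _ (lead_coef G)) ?lead_coef_eq0 // -mul_polyC e dvdp_add // dvdp_mull.
rewrite -(@dvdpZr _ (ev (lead_coef G))) ?vanishing_lead // -mul_polyC.
have -> : (ev (lead_coef G))%:P = map_poly (horner_eval c0) (lead_coef G)%:P by rewrite map_polyC.
by rewrite -rmorphM e rmorphD rmorphM dvdp_add // dvdp_mull.
Qed.

End Line.
End Derivations.

(** * Lüroth's theorem for first integrals *)

Lemma classic_min (P : nat -> Prop) : (exists n, P n) ->
  exists n, P n /\ forall m, P m -> (n <= m)%N.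
Proof.
move=> [n]; elim/ltn_ind: n => n IH Pn.
have [[m [hm Pm]]|h] := classic (exists m, (m < n)%N /\ P m); first exact: IH Pm.
by exists n; split=> // m Pm; rewrite leqNgt; apply/negP => hm; apply: h; exists m.
Qed.

(** The hypothesis is linear independence of [x] and [y] over [K], so the coefficients of top degree
    cannot cancel. *)
Lemma size_pencil (K : fieldType) (E : idomainType) (h : {rmorphism K -> E})
    (x y : E) (a b : {poly K}) :
  (forall c d, (c != 0) || (d != 0) -> h c * x - h d * y != 0) ->
  size (x *: map_poly h a - y *: map_poly h b) = maxn (size a) (size b).
Proof.
move=> hxy; set P := (X in size X).
have cP j : P`_j = h a`_j * x - h b`_j * y by rewrite coefB !coefZ !coef_map mulrC [y * _]mulrC.
apply/eqP; rewrite eqn_leq; apply/andP; split.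
  apply/leq_sizeP => j; rewrite geq_max => /andP[ha hb].
  by rewrite cP !nth_default // rmorph0 !mul0r subrr.
case en : (maxn _ _) => [//|n]; rewrite ltnNge; apply/negP => /(nth_default 0)/eqP; apply/negP.
rewrite cP; apply: hxy; rewrite -negb_and; apply/negP => /andP[/eqP ha /eqP hb].
have hle (c : {poly K}) : (size c <= n.+1)%N -> c`_n = 0 -> (size c <= n)%N.
  move=> hc c0; apply/leq_sizeP => j; rewrite leq_eqVlt => /orP[/eqP <- //|hj].
  by rewrite nth_default // (leq_trans hc).
have : (maxn (size a) (size b) <= n)%N by rewrite geq_max !hle //; lia.
by rewrite en ltnn.
Qed.

(** * Substitution of a nonconstant fraction into a polynomial *)

Section Substitution.
Variable C : numClosedFieldType.
Local Notation R := {poly {poly C}}.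
Local Notation F := {fraction {poly {poly C}}}.

Definition cstF : C -> F := (@tofrac R) \o (polyC \o polyC).
HB.instance Definition _ := GRing.RMorphism.copy cstF ((@tofrac R) \o (polyC \o polyC)).

Definition subF (p q : R) : {poly C} -> F :=
  horner_eval (tofrac p / tofrac q) \o map_poly cstF.
HB.instance Definition _ p q := GRing.RMorphism.copy (subF p q)
  (horner_eval (tofrac p / tofrac q) \o map_poly cstF).

Lemma cstFE c : cstF c = tofrac (cst2 c). Proof. by []. Qed.

Variables p q : R.
Hypotheses (q0 : q != 0) (npq : nonconst p q).

Lemma subFE U : subF p q U = (map_poly cstF U).[tofrac p / tofrac q].
Proof. by []. Qed.

Lemma subFX : subF p q 'X = tofrac p / tofrac q.
Proof. by rewrite subFE map_polyX hornerX. Qed.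

Lemma subFC c : subF p q c%:P = cstF c.
Proof. by rewrite subFE map_polyC hornerC. Qed.

(** A nonconstant fraction is transcendental: [U] splits into linear factors over [C], and p/q - z
    is nonzero for every constant z. *)
Lemma subF_eq0 U : (subF p q U == 0) = (U == 0).
Proof.
apply/idP/idP => [|/eqP ->]; last by rewrite rmorph0.
apply: contraTT => U0; have [r ->] := closed_field_poly_normal U.
rewrite -mul_polyC rmorphM rmorph_prod /= subFC mulf_neq0 //.
  by rewrite cstFE tofrac_eq0 cst2_eq0 lead_coef_eq0.
rewrite prodf_seq_neq0; apply/allP => z _; rewrite rmorphB /= subFX subFC subr_eq0.
apply/negP => /eqP h; apply: (npq (c := z)).
by apply/eqP; rewrite -tofrac_eq tofracM -cstFE -h divfK // tofrac_eq0.
Qed.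

Lemma subF_hcomp n (U : {poly C}) : (size U <= n.+1)%N ->
  tofrac (hcomp n U p q) = tofrac q ^+ n * subF p q U.
Proof.
move=> hU; rewrite subFE (@horner_coef_wide _ (size U)) ?size_map_poly ?size_poly //.
rewrite /hcomp rmorph_sum mulr_sumr; apply: eq_bigr => i _.
rewrite !rmorphM !rmorphXn coef_map /= -cstFE exprMn exprVn -mulrA.
have hi : (i <= n)%N by rewrite -ltnS (leq_trans (ltn_ord i)).
have qF : tofrac q ^+ i != 0 by rewrite expf_neq0 // tofrac_eq0.
have -> : tofrac q ^+ n = tofrac q ^+ (n - i) * tofrac q ^+ i by rewrite -exprD subnK.
by rewrite -[RHS]mulrA [tofrac q ^+ i * _]mulrCA [tofrac q ^+ i * _]mulrCA mulfV // mulr1 [RHS]mulrC mulrA.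
Qed.

Lemma hcomp_eq n (U V : {poly C}) (a b : R) :
  (size U <= n.+1)%N -> (size V <= n.+1)%N ->
  tofrac b * subF p q U = tofrac a * subF p q V ->
  b * hcomp n U p q = a * hcomp n V p q.
Proof.
move=> hU hV e; apply/eqP; rewrite -tofrac_eq !tofracM !subF_hcomp //.
by rewrite mulrCA e mulrCA.
Qed.

End Substitution.

Section Luroth.
Variable C : numClosedFieldType.
Local Notation R := {poly {poly C}}.
Variable D : R -> R.
Hypothesis hD : is_deriv D.
Variables s y0 : C.
Let c0 : {poly C} := y0%:P + s *: 'X.
Local Notation ev p := (p : R).[c0].
Hypothesis hell : ev (D ('X - c0%:P)) != 0.
Local Notation FI := (first_int D).

(* p/q equals g1/g2 on the line. *)
Definition restricts (p q : R) (g1 g2 : {poly C}) :=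
  g2 != 0 /\ ev p * g2 = g1 * ev q.

(** The largest such [M] is one more than the degree of a Lüroth generator of the field of
    restricted first integrals. *)
Definition degree_bound M := forall p q g1 g2, FI p q -> ev q != 0 -> nonconst p q ->
  restricts p q g1 g2 -> (M <= maxn (size g1) (size g2))%N.

Lemma ev_neq0 (q : R) : ev q != 0 -> q != 0.
Proof. by apply: contraNneq => ->; rewrite horner0. Qed.

Lemma nonconst_comb (p q : R) (c d : C) : q != 0 -> nonconst p q ->
  (c != 0) || (d != 0) -> cst2 c * q - cst2 d * p != 0.
Proof.
move=> q0 npq cd; have [d0|d0] := eqVneq d 0.
  by rewrite d0 cst20 mul0r subr0 mulf_neq0 // cst2_eq0; move: cd; rewrite d0 eqxx orbF.
apply/eqP => /eqP; rewrite subr_eq0 => /eqP h; apply: (npq (c / d)).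
apply: (mulfI (_ : cst2 d != 0)); first by rewrite cst2_eq0.
by rewrite -h mulrA -cst2M mulrCA mulfV // mulr1.
Qed.

Lemma restricts_indep p q g1 g2 (c d : C) : FI p q -> ev q != 0 -> nonconst p q ->
  restricts p q g1 g2 -> (c != 0) || (d != 0) -> c%:P * g2 - d%:P * g1 != 0.
Proof.
move=> pq hq npq [g20 e] cd; have [d0|d0] := eqVneq d 0.
  by rewrite d0 mul0r subr0 mulf_neq0 // polyC_eq0; move: cd; rewrite d0 eqxx orbF.
apply/eqP => /eqP; rewrite subr_eq0 => /eqP h; apply: (npq (c / d)).
apply: (FI_const hD hell pq hq); apply: (mulIf g20); rewrite e.
apply: (mulfI (_ : d%:P != 0)); first by rewrite polyC_eq0.
rewrite [LHS]mulrA -h [RHS]mulrA [d%:P * _]mulrA -polyCM [d * _]mulrCA mulfV // mulr1.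
by rewrite mulrAC.
Qed.

Lemma restricts_coprime p q g1 g2 : restricts p q g1 g2 -> exists h1 h2,
  [/\ coprimep h1 h2, restricts p q h1 h2, (size h1 <= size g1)%N & (size h2 <= size g2)%N].
Proof.
move=> [g20 e]; pose d := gcdp g1 g2.
have d0 : d != 0 by rewrite gcdp_eq0 (negPf g20) andbF.
have e1 : g1 = g1 %/ d * d by rewrite divpK // dvdp_gcdl.
have e2 : g2 = g2 %/ d * d by rewrite divpK // dvdp_gcdr.
exists (g1 %/ d), (g2 %/ d); split; rewrite ?leq_divp //.
  by rewrite coprimep_div_gcd // g20 orbT.
split; first by apply: contraNneq g20 => h; rewrite e2 h mul0r.
by apply: (mulIf d0); rewrite -mulrA -e2 e {1}e1; ring.
Qed.

Local Notation up h := (map_poly (polyC \o polyC) (h : {poly C}) : {poly R}).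

(** Lüroth's polynomial h1(T) - h(t) h2(T), with the first integral p/q in place of its restriction
    h(t) and the denominator cleared. *)
Definition graph_poly (p q : R) (h1 h2 : {poly C}) : {poly R} := q *: up h1 - p *: up h2.

Lemma ev_up h : map_poly (horner_eval c0) (up h) = map_poly polyC h.
Proof.
rewrite -map_poly_comp; apply: eq_map_poly => x /=.
by rewrite /horner_eval hornerC.
Qed.

Lemma ev_graph p q h1 h2 : map_poly (horner_eval c0) (graph_poly p q h1 h2) =
  ev q *: map_poly polyC h1 - ev p *: map_poly polyC h2.
Proof. by rewrite /graph_poly rmorphB /= !map_polyZ /= !ev_up. Qed.

Lemma hornerX_polyC (h : {poly C}) : (map_poly polyC h).['X] = h.
Proof. exact: comp_polyXr. Qed.

Lemma vanishing_graph p q h1 h2 : FI p q -> ev q != 0 -> restricts p q h1 h2 ->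
  vanishing D s y0 (graph_poly p q h1 h2).
Proof.
move=> pq hq [_ e]; exists q; split=> //.
- move=> j; rewrite coefB !coefZ !coef_map /= -/(cst2 _) -/(cst2 _) [q * _]mulrC [p * _]mulrC.
  by apply: FIB => //; apply: FIC => //; apply: FI_refl.
- by rewrite ev_graph hornerD hornerN !hornerZ !hornerX_polyC e mulrC subrr.
Qed.

Lemma size_graph p q h1 h2 : q != 0 -> nonconst p q ->
  size (graph_poly p q h1 h2) = maxn (size h1) (size h2).
Proof. by move=> q0 npq; apply: size_pencil => c d; apply: nonconst_comb. Qed.

(* The vanishing polynomial G of least degree is, up to a factor, the graph of p/q: it has
   degree at least M in t because some coefficient of G is nonconstant, hence the cofactor of G
   in the restricted graph is independent of t, hence constant. *)
Lemma graph_minimal M p q h1 h2 a b a1 a2 : degree_bound M -> FI p q -> ev q != 0 ->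
  nonconst p q -> coprimep h1 h2 -> restricts p q h1 h2 ->
  (size h1 <= M)%N -> (size h2 <= M)%N ->
  FI a b -> ev b != 0 -> restricts a b a1 a2 ->
  graph_poly p q h1 h2 %| graph_poly a b a1 a2.
Proof.
move=> hM pq hq npq cop rh sh1 sh2 ab hb ra.
have q0 := ev_neq0 hq; have [h20 eh] := rh.
have vP := vanishing_graph pq hq rh; set P := graph_poly p q h1 h2 in vP *.
have szP : size P = maxn (size h1) (size h2) by apply: size_graph.
have P0 : P != 0 by rewrite -size_poly_gt0 szP leq_max !size_poly_gt0 h20 orbT.
have [|n [[G [vG G0 sG]] nmin]] := @classic_min (fun n =>
  exists G, [/\ vanishing D s y0 G, G != 0 & size G = n]).
  by exists (size P), P.
have Gmin P' : vanishing D s y0 P' -> P' != 0 -> (size G <= size P')%N.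
  by move=> vP' P'0; rewrite sG; apply: nmin; exists P'.
have Gdvd := vanishing_min_dvd hD hell vG G0 Gmin.
have [GP evGP] := Gdvd _ vP; have [GQ _] := Gdvd _ (vanishing_graph ab hb ra).
have evl := vanishing_lead hD hell vG G0.
have [w [w0 hw Gt]] := vG.
set evm := map_poly (horner_eval c0) in evGP Gt.
pose Gam : {poly {poly C}} := evm G.
have lGam : Gam`_(size G).-1 = ev (lead_coef G) by rewrite /Gam /evm coef_map.
have Gam0 : Gam != 0 by apply: contraNneq evl => h; rewrite -lGam h coef0.
have szGam : size Gam = size G by rewrite /Gam /evm size_map_poly_id0 //= horner_evalE.
have fP : factorial {poly C} := poly_factorial (@field_factorial C).
have [c [Phi [cn0 eGam pPhi]]] := content fP Gam0.
(* [Psi] is h2(t) h1(T) - h1(t) h2(T), with t inner and T outer. The primitive part [Phi] of the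
   restricted [G] divides it in C[t][T], so degrees in t can be compared. *)
pose Psi : {poly {poly C}} := h2 *: map_poly polyC h1 - h1 *: map_poly polyC h2.
have ePsi : h2 *: evm P = ev q *: Psi.
  rewrite /evm ev_graph /Psi !scalerBr !scalerA [h2 * ev p]mulrC eh.
  by rewrite [h2 * _]mulrC [h1 * _]mulrC.
have indep c d := restricts_indep pq hq npq rh (c := c) (d := d).
have szPsi : size Psi = maxn (size h1) (size h2).
  by apply: (size_pencil (h := polyC)) => c' d'; apply: indep.
have PhiPsi : dvdr Phi Psi.
  apply: (gauss_dvdp fP pPhi); rewrite -(@dvdpZr _ (ev q)) // -ePsi dvdpZr //.
  by apply: dvdp_trans evGP; rewrite -/Gam eGam dvdp_mull.
have [S eS] := PhiPsi.
have Psi0 : Psi != 0 by rewrite -size_poly_gt0 szPsi leq_max !size_poly_gt0 h20 orbT.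
have [S0 Phi0] : S != 0 /\ Phi != 0 by apply/andP; rewrite -negb_or -mulf_eq0 -eS.
have szPhi : size Phi = size G by rewrite -szGam eGam mul_polyC size_scale.
(* Otherwise the restricted [G] would be, up to a factor, a polynomial over [C] with the root t,
   hence zero. *)
have [j hj] : exists j, nonconst G`_j (lead_coef G).
  apply: NNPP => hn.
  have hc j : exists c, G`_j = cst2 c * lead_coef G.
    by apply: NNPP => h; apply: hn; exists j => c' e; apply: h; exists c'.
  pose cj j := proj1_sig (constructive_indefinite_description _ (hc j)).
  have hcj j : G`_j = cst2 (cj j) * lead_coef G by rewrite /cj; case: constructive_indefinite_description.
  pose g := \poly_(i < size G) cj i.
  have eg : Gam = ev (lead_coef G) *: map_poly polyC g.
    apply/polyP => i; rewrite /Gam /evm coef_map coefZ coef_map coef_poly.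
    case: ltnP => hi; last by rewrite (nth_default 0 hi) /= /horner_eval horner0 polyC0 mulr0.
    by rewrite hcj /= /horner_eval hornerM ev_cst2 mulrC.
  move: Gt; rewrite -/Gam eg hornerZ hornerX_polyC => /eqP.
  rewrite mulf_eq0 (negPf evl) /= => /eqP g0.
  by move: Gam0; rewrite eg g0 rmorph0 scaler0 eqxx.
have FIj : FI G`_j (lead_coef G) by apply: FI_trans (ev_neq0 w0) (hw _) (hw _).
have hMj : (M <= maxn (size (Phi`_j)%R) (size (Phi`_(size G).-1)%R))%N.
  apply: (hM _ _ _ _ FIj evl hj); split.
    by apply: contraNneq Phi0 => h; rewrite -lead_coef_eq0 lead_coefE szPhi h.
  have -> : ev G`_j = c * Phi`_j by rewrite -coefCM -eGam /Gam /evm coef_map.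
  by rewrite -lGam eGam coefCM; ring.
have hMY : (M <= sizeY Phi)%N.
  by apply: leq_trans hMj _; rewrite geq_max !max_size_coefXY.
have PsiY : (sizeY Psi <= M)%N.
  apply/bigmax_leqP => i _; rewrite /Psi coefB !coefZ !coef_map /=.
  apply: leq_trans (size_polyD _ _) _; rewrite geq_max size_polyN.
  rewrite ![_ * _%:P]mulrC !mul_polyC.
  by rewrite !(leq_trans (size_scale_leq _ _)).
have sS : (size (swapXY S) <= 1)%N.
  move: PsiY; rewrite sizeYE eS rmorphM size_mul ?swapXY_eq0 //.
  by move: hMY; rewrite sizeYE; move: (size (swapXY S)) (size (swapXY Phi)) => x z; clear; lia.
have [t et] : exists t : {poly C}, S = map_poly polyC t.
  by exists (swapXY S)`_0; rewrite -swapXY_polyC -size1_polyC // swapXYK.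
(* A root z of the cofactor would give h2(t) h1(z) = h1(t) h2(z), although h1/h2 is nonconstant and
   h1, h2 have no common root. *)
have st : size t = 1%N.
  apply/eqP; rewrite -[_ == _]negbK; apply/negP => /closed_rootP[z rz].
  have : Psi.[z%:P] = 0 by rewrite eS et hornerM horner_map (rootP rz) mul0r.
  rewrite /Psi hornerD hornerN !hornerZ !horner_map /= mulrC [h1 * _]mulrC => /eqP; apply/negP.
  apply: indep; rewrite -negb_and; apply/negP => /andP[r1 r2].
  have := coprimep_root cop r1; by rewrite (eqP r2) eqxx.
have szSG : size G = size P.
  rewrite szP -szPsi eS size_mul // szPhi et size_map_polyC st //.
have : P %= G by rewrite eqp_sym -dvdp_size_eqp // szSG.
by move=> /eqp_dvdl ->.
Qed.

End Luroth.

Section LurothField.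
Variable C : numClosedFieldType.
Local Notation R := {poly {poly C}}.
Variable D : R -> R.
Hypothesis hD : is_deriv D.
Variables s y0 : C.
Let c0 : {poly C} := y0%:P + s *: 'X.
Local Notation ev p := (p : R).[c0].
Hypothesis hell : ev (D ('X - c0%:P)) != 0.
Local Notation FI := (first_int D).
Local Notation upF h := (map_poly (@cstF C) h).

Implicit Types (p q a b : R) (h : {poly C}).

Lemma map_tofrac_graph p q h1 h2 : map_poly (@tofrac R) (graph_poly p q h1 h2) =
  tofrac q *: upF h1 - tofrac p *: upF h2.
Proof.
rewrite /graph_poly rmorphB /= !map_polyZ -!map_poly_comp.
by congr (_ *: _ - _ *: _); apply: eq_map_poly.
Qed.

(** Modulo h1(T) - (p/q) h2(T) the polynomials a1(T) and a2(T) have remainders over C(p/q). The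
    divisibility forces b r1 = a r2 up to multipliers in C[p/q], and one coefficient in T exhibits
    a/b as a function of p/q. *)
Lemma luroth_graph p q h1 h2 a b (a1 a2 : {poly C}) : q != 0 -> nonconst p q -> b != 0 ->
  h2 != 0 -> coprimep a1 a2 -> (1 < maxn (size h1) (size h2))%N ->
  graph_poly p q h1 h2 %| graph_poly a b a1 a2 ->
  exists U V, coprimep U V /\ tofrac b * subF p q U = tofrac a * subF p q V.
Proof.
move=> q0 npq b0 h20 copa sh.
pose phi := subF p q.
(* The inner variable is a placeholder for p/q, for which [phi] substitutes it. *)
pose Pi : {poly {poly C}} := map_poly polyC h1 - 'X *: map_poly polyC h2.
pose Pih := map_poly phi Pi.
have upE (h : {poly C}) : map_poly phi (map_poly polyC h) = upF h.
  by rewrite -map_poly_comp; apply: eq_map_poly => x /=; rewrite /phi subFC.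
have ePih : Pih = upF h1 - (tofrac p / tofrac q) *: upF h2.
  by rewrite /Pih rmorphB /= map_polyZ /= !upE /phi subFX.
have qF : tofrac q != 0 by rewrite tofrac_eq0.
have szPih : size Pih = maxn (size h1) (size h2).
  rewrite ePih -[upF h1]scale1r; apply: size_pencil => c d cd.
  have := nonconst_comb q0 npq cd; rewrite -tofrac_eq0 tofracB !tofracM -!cstFE.
  apply: contraNN => /eqP h; apply/eqP; transitivity (tofrac q * 0); last by rewrite mulr0.
  by rewrite -h mulr1 mulrBr [tofrac q * cstF c]mulrC; congr (_ - _); rewrite mulrCA [_ * (_ / _)]mulrC divfK.
have phi_inj U : (phi U == 0) = (U == 0) by apply: subF_eq0.
have Pi0 : Pi != 0.
  by apply: contraTneq sh => h; rewrite -szPih /Pih h rmorph0 size_poly0.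
have szPi : size Pi = size Pih.
  have hl : phi (lead_coef Pi) != 0 by rewrite phi_inj lead_coef_eq0.
  by rewrite /Pih (size_map_poly_id0 hl).
move=> /Pdiv.Idomain.dvdpP[[c W] /= cn0 eW].
have PiQ : Pih %| map_poly (@tofrac R) (graph_poly a b a1 a2).
  move/(congr1 (map_poly (@tofrac R))): eW; rewrite rmorphM /= map_polyZ => eW.
  rewrite -(@dvdpZr _ (tofrac c)) ?tofrac_eq0 //= eW dvdp_mull // map_tofrac_graph.
  have -> : tofrac q *: upF h1 - tofrac p *: upF h2 = tofrac q *: Pih.
    by rewrite ePih scalerBr scalerA mulrC divfK.
  by rewrite dvdpZr.
pose A1 := map_poly (@polyC C) a1; pose A2 := map_poly (@polyC C) a2.
have d1 := Pdiv.Idomain.divp_eq A1 Pi; have d2 := Pdiv.Idomain.divp_eq A2 Pi.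
set c1 := _ ^+ _ in d1; set c2 := _ ^+ _ in d2.
have c10 : phi c1 != 0 by rewrite phi_inj expf_neq0 // lead_coef_eq0.
have c20 : phi c2 != 0 by rewrite phi_inj expf_neq0 // lead_coef_eq0.
have e1 : phi c1 *: upF a1 = map_poly phi (A1 %/ Pi) * Pih + map_poly phi (A1 %% Pi).
  by rewrite -upE -[phi c1 *: _]map_polyZ d1 rmorphD rmorphM.
have e2 : phi c2 *: upF a2 = map_poly phi (A2 %/ Pi) * Pih + map_poly phi (A2 %% Pi).
  by rewrite -upE -[phi c2 *: _]map_polyZ d2 rmorphD rmorphM.
pose r1 := A1 %% Pi; pose r2 := A2 %% Pi.
pose E := (tofrac b * phi c2) *: map_poly phi r1 - (tofrac a * phi c1) *: map_poly phi r2.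
have szr (r : {poly {poly C}}) x : (size r < size Pi)%N -> (size (x *: map_poly phi r) < size Pi)%N.
  by move=> h; apply: leq_ltn_trans h; apply: leq_trans (size_scale_leq _ _) (size_poly _ _).
have E0 : E = 0.
  apply/eqP; apply: contraTT (_ : Pih %| E) => [En0|].
    rewrite gtNdvdp // -szPi; apply: leq_ltn_trans (size_polyD _ _) _.
    by rewrite size_polyN gtn_max !szr // ltn_modp.
  have -> : E = (phi c1 * phi c2) *: (tofrac b *: upF a1 - tofrac a *: upF a2) -
     ((tofrac b * phi c2) *: map_poly phi (A1 %/ Pi) - (tofrac a * phi c1) *: map_poly phi (A2 %/ Pi)) * Pih.
    rewrite scalerBr !scalerA.
    have -> : phi c1 * phi c2 * tofrac b = (tofrac b * phi c2) * phi c1 by ring.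
    have -> : phi c1 * phi c2 * tofrac a = (tofrac a * phi c1) * phi c2 by ring.
    rewrite -![(_ * phi _ * phi _) *: _]scalerA e1 e2 /E mulrBl -!scalerAl !scalerDr /r1 /r2.
    have aux (x y z w : {poly {fraction R}}) : y - w = (x + y) - (z + w) - (x - z) by ring.
    exact: aux.
  rewrite dvdp_sub //; last by rewrite dvdp_mull.
  rewrite (dvdpZr _ _ (mulf_neq0 c10 c20)) -map_tofrac_graph; exact: PiQ.
have Ej j : tofrac b * phi (c2 * r1`_j) = tofrac a * phi (c1 * r2`_j).
  move/(congr1 (fun P : {poly _} => P`_j)): E0; rewrite coefB !coefZ !coef_map coef0 => /eqP.
  by rewrite subr_eq0 => /eqP; rewrite /phi !rmorphM /= !mulrA.
have [r20|r20] := eqVneq r2 0; last first.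
  pose j := (size r2).-1; have hj : c1 * r2`_j != 0.
    by rewrite mulf_neq0 // ?lead_coef_eq0 // -phi_inj.
  pose U0 := c2 * r1`_j; pose V0 := c1 * r2`_j; pose d := gcdp U0 V0.
  have d0 : d != 0 by rewrite gcdp_eq0 negb_and hj orbT.
  exists (U0 %/ d), (V0 %/ d); split; first by rewrite coprimep_div_gcd // hj orbT.
  apply: (mulIf (_ : phi d != 0)); first by rewrite phi_inj.
  rewrite -!mulrA -!rmorphM !divpK ?dvdp_gcdl ?dvdp_gcdr //; exact: Ej.
(* Both remainders vanish here, so [Pi] divides [A1] and [A2], against the coprimality of [a1] and
   [a2]. *)
exfalso.
have r10 : r1 = 0.
  apply/polyP => j; rewrite coef0; have := Ej j; rewrite r20 coef0 mulr0 {2}/phi rmorph0 mulr0 => /eqP.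
  rewrite mulf_eq0 tofrac_eq0 (negPf b0) phi_inj mulf_eq0 -phi_inj (negPf c20) /=; exact: eqP.
have p1 : Pi %| A1 by apply/modp_eq0P.
have p2 : Pi %| A2 by apply/modp_eq0P.
have [[u v] /= uv] := (Bezout_eq1_coprimepP a1 a2) copa.
have : Pi %| 1.
  have <- : map_poly polyC (u * a1 + v * a2) = 1 by rewrite uv rmorph1.
  by rewrite rmorphD !rmorphM dvdp_add // dvdp_mull.
move/(dvdp_leq (oner_neq0 _)); rewrite size_poly1 szPi szPih; move: sh; clear; lia.
Qed.

(** Here [b] may vanish on the line; by [FI_mult], a nonzero [a] contains the same power of its
    equation as [b], and removing it makes [a/b] restrictable. *)
Lemma luroth M p q h1 h2 a b : degree_bound D s y0 M -> FI p q -> ev q != 0 ->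
  nonconst p q -> restricts s y0 p q h1 h2 -> (size h1 <= M)%N -> (size h2 <= M)%N ->
  FI a b -> b != 0 ->
  exists U V, coprimep U V /\ tofrac b * subF p q U = tofrac a * subF p q V.
Proof.
move=> hM pq hq npq r0 s1 s2 ab b0.
have q0 := ev_neq0 hq.
have [h1' [h2' [cop rh s1' s2']]] := restricts_coprime r0.
have [->|a0] := eqVneq a 0.
  exists 0, 1; split; first by rewrite coprimep1.
  by rewrite rmorph0 mulr0 tofrac0 mul0r.
have [n [a' [ea ha']]] := ell_mult s y0 a0.
have [k [b' [eb hb']]] := ell_mult s y0 b0.
have nk : n = k by move: ab; rewrite ea eb => /(FI_mult hD hell); apply.
have l0 : ('X - c0%:P) ^+ n != 0 by rewrite expf_neq0 // polyXsubC_eq0.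
have ab' : FI a' b' by move: ab; rewrite ea eb -nk => /(FI_cancel hD l0).
have ra : restricts s y0 a' b' (ev a') (ev b') by [].
have [a1 [a2 [copa ra' _ _]]] := restricts_coprime ra.
have [U [V [cUV e]]] : exists U V, coprimep U V /\ tofrac b' * subF p q U = tofrac a' * subF p q V.
  apply: (@luroth_graph p q h1' h2' a' b' a1 a2) => //.
  - exact: ev_neq0 hb'.
  - by case: rh.
  - rewrite ltnNge geq_max; apply/negP => /andP[/size1_polyC e1 /size1_polyC e2].
    have h20 : h2'`_0 != 0 by case: rh => h _; move: h; rewrite {1}e2 polyC_eq0.
    have := @restricts_indep _ _ hD _ _ hell _ _ _ _ h1'`_0 h2'`_0 pq hq npq rh.
    by rewrite h20 orbT -e1 -e2 mulrC subrr eqxx => /(_ isT).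
  apply: (graph_minimal hD hell hM pq hq npq cop rh _ _ ab' hb' ra').
    exact: leq_trans s1' s1.
  exact: leq_trans s2' s2.
exists U, V; split=> //; rewrite ea eb -nk !tofracM mulrAC e; ring.
Qed.

End LurothField.

(** * An indecomposable first integral generates all first integrals *)

Section Indecomposable.
Variable C : numClosedFieldType.
Local Notation R := {poly {poly C}}.
Implicit Types (A B W p q a b f g : R).

Lemma horner_line_neq0 W (s : C) : W != 0 -> exists y0 : C, W.[y0%:P + s *: 'X] != 0.
Proof.
move=> W0; apply: NNPP => h.
pose rs := [seq (i%:R : C)%:P + s *: 'X | i <- iota 0 (size W)].
have hroot : all (root W) rs.
  apply/allP => _ /mapP[i _ ->]; rewrite rootE; apply/negPn/negP => hi.
  by apply: h; exists i%:R.
have hu : uniq rs.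
  rewrite map_inj_uniq ?iota_uniq // => i j /addIr/polyC_inj/eqP.
  by rewrite eqr_nat => /eqP.
by have := max_poly_roots W0 hroot hu; rewrite size_map size_iota ltnn.
Qed.

Lemma derivation_line A B (s y0 : C) :
  derivation A B ('X - (y0%:P + s *: 'X)%:P) = B - cst2 s * A.
Proof.
rewrite /derivation (derB (@dX_deriv C)) (derB (@dY_deriv C)).
have -> : dX ('X : R) = 0.
  by apply/polyP => j; rewrite /dX coef_map_id0 ?deriv0 // coefX coef0;
     case: eqP => _; rewrite ?derivC // deriv0.
have -> (c : {poly C}) : dX (c%:P : R) = (c^`())%:P.
  by apply/polyP => j; rewrite /dX coef_map_id0 ?deriv0 // !coefC; case: eqP => _; rewrite ?deriv0.
rewrite /dY derivX derivC derivD derivC derivZ derivX add0r subr0 mulr1 alg_polyC.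
by rewrite /cst2; ring.
Qed.

Lemma line_exists A B W : (A != 0) || (B != 0) -> W != 0 -> exists s y0 : C,
  (derivation A B ('X - (y0%:P + s *: 'X)%:P)).[y0%:P + s *: 'X] != 0 /\
  W.[y0%:P + s *: 'X] != 0.
Proof.
move=> AB W0; have [s hs] : exists s : C, B - cst2 s * A != 0.
  have [B0|B0] := eqVneq B 0.
    exists 1; rewrite B0 sub0r oppr_eq0 mulf_neq0 ?cst2_eq0 ?oner_eq0 //.
    by move: AB; rewrite B0 eqxx orbF.
  by exists 0; rewrite cst20 mul0r subr0.
have [y0] := horner_line_neq0 s (mulf_neq0 hs W0).
by rewrite hornerM mulf_eq0 negb_or -(derivation_line A B s y0) => /andP[h1 h2]; exists s, y0.
Qed.

(* Lüroth writes f/g as u(h); indecomposability forces deg u = 1, so every member of the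
   pencil generated by f and g has the minimal degree on the line. *)
Lemma indecomposable_field A B f g (al be ga de : C) (D := derivation A B) :
  (A != 0) || (B != 0) -> first_int D f g -> g != 0 -> nonconst f g ->
  ~ decomposable f g -> al * de - be * ga != 0 ->
  let p1 := cst2 al * f + cst2 be * g in let p2 := cst2 ga * f + cst2 de * g in
  forall a b, first_int D a b -> b != 0 -> exists n U V,
  [/\ coprimep U V, (size U <= n.+1)%N, (size V <= n.+1)%N &
      b * hcomp n U p1 p2 = a * hcomp n V p1 p2].
Proof.
move=> AB fg g0 nfg ndec det p1 p2.
have hD : is_deriv D by apply: derivation_deriv.
have [s [y0 [hell hg]]] := line_exists AB g0.
set c0 := y0%:P + s *: 'X in hell hg.
have [|M [[p [q [h1 [h2 [pq hq npq rh eM]]]]] Mmin]] := @classic_min (fun M =>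
  exists p q h1 h2, [/\ first_int D p q, q.[c0] != 0, nonconst p q,
    restricts s y0 p q h1 h2 & M = maxn (size h1) (size h2)]).
  by exists (maxn (size f.[c0]) (size g.[c0])), f, g, f.[c0], g.[c0].
have hM : degree_bound D s y0 M.
  by move=> p' q' g1 g2 h h' h'' h'''; apply: Mmin; exists p', q', g1, g2.
have [s1 s2] : (size h1 <= M)%N /\ (size h2 <= M)%N by rewrite eM leq_maxl leq_maxr.
have q0 := ev_neq0 hq; have [h20 eh] := rh.
have [U [V [cUV e]]] := luroth hD hell hM pq hq npq rh s1 s2 fg g0.
have rd : (rdeg U V < 2)%N.
  rewrite ltnNge; apply/negP => hd; apply: ndec; exists U, V, p, q; split=> //.
  apply/esym; apply: (hcomp_eq q0 _ _ e); rewrite /rdeg; move: (size U) (size V) => x y; clear; lia.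
have [sU sV] : (size U <= 2)%N /\ (size V <= 2)%N.
  by move: rd; rewrite /rdeg; move: (size U) (size V) => x y; clear; lia.
have lin (W : {poly C}) : (size W <= 2)%N -> hcomp 1 W p q = cst2 W`_0 * q + cst2 W`_1 * p.
  move=> sW; rewrite /hcomp.
  rewrite (big_ord_widen 2 (fun i => cst2 W`_i * p ^+ i * q ^+ (1 - i))) // big_mkcond.
  rewrite !big_ord_recl big_ord0 /= addr0 !expr0 !expr1 !mulr1.
  by congr (_ + _); case: ltnP => // h; rewrite nth_default // cst20 !mul0r.
have E := hcomp_eq q0 (n := 1) sU sV e; rewrite !lin // in E.
(* [lh U / lh V] is the restriction of f/g with sizes at most [M]; the restrictions of [f] and [g]
   themselves may be larger because of common factors. *)
pose lh (W : {poly C}) := (W`_0)%:P * h2 + (W`_1)%:P * h1.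
have evlin (W : {poly C}) : (cst2 W`_0 * q + cst2 W`_1 * p).[c0] * h2 = q.[c0] * lh W.
  rewrite hornerD !hornerM !ev_cst2 mulrDl -[_ * p.[c0] * h2]mulrA eh /lh; ring.
have E' : f.[c0] * lh V = g.[c0] * lh U.
  apply: (mulfI hq); rewrite mulrCA -evlin [RHS]mulrCA -evlin !mulrA -!hornerM.
  by rewrite E.
have lh0 (W : {poly C}) : (size W <= 2)%N -> lh W = 0 -> W = 0.
  move=> sW hW; apply/polyP => i; rewrite coef0.
  have : ~~ ((W`_0 != 0) || (W`_1 != 0)).
    apply/negP => hn; have := restricts_indep hD hell (c := W`_0) (d := - W`_1) pq hq npq rh.
    by rewrite oppr_eq0 hn polyCN mulNr opprK -/(lh W) hW eqxx => /(_ isT).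
  rewrite negb_or !negbK => /andP[/eqP w0 /eqP w1].
  by case: i => [|[|i]] //; rewrite nth_default // (leq_trans sW).
have hV : lh V != 0.
  apply/eqP => hV; move: E'; rewrite hV mulr0 => /esym/eqP.
  rewrite mulf_eq0 (negPf hg) /= => /eqP /(lh0 _ sU) hU.
  by move: cUV; rewrite hU (lh0 _ sV hV) coprimep_def gcdp0 size_poly0.
have cdet : (al * de - be * ga) != 0 by [].
have comb (x y : C) : (x != 0) || (y != 0) -> (cst2 x * f + cst2 y * g).[c0] != 0.
  move=> xy; apply/eqP => h0.
  have rfg : restricts s y0 f g f.[c0] g.[c0] by [].
  have := restricts_indep hD hell (c := y) (d := - x) fg hg nfg rfg.
  rewrite oppr_eq0 orbC xy => /(_ isT); rewrite polyCN mulNr opprK addrC.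
  by move: h0; rewrite hornerD !hornerM !ev_cst2 => ->; rewrite eqxx.
have gd : (ga != 0) || (de != 0).
  by rewrite -negb_and; apply: contra cdet => /andP[/eqP -> /eqP ->]; rewrite !mulr0 subrr.
have hp2 : p2.[c0] != 0 by apply: comb.
have FIp : first_int D p1 p2.
  rewrite /first_int /p1 /p2 !(derD hD) !(derM hD) !(derC hD) !mul0r !add0r.
  apply/eqP; rewrite -subr_eq0; apply/eqP.
  transitivity ((cst2 al * cst2 de - cst2 be * cst2 ga) * (g * D f - f * D g)); first by ring.
  by rewrite fg subrr mulr0.
have np : nonconst p1 p2.
  move=> c ec; have : (cst2 (al - c * ga) * f + cst2 (be - c * de) * g).[c0] = 0.
    rewrite !cst2D !cst2N !cst2M; transitivity ((p1 - cst2 c * p2).[c0]); last by rewrite ec subrr horner0.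
    by congr _.[_]; rewrite /p1 /p2; ring.
  apply/eqP/comb; rewrite -negb_and; apply: contra cdet; rewrite !subr_eq0 => /andP[/eqP -> /eqP ->].
  by apply/eqP; ring.
have rp : restricts s y0 p1 p2 (al%:P * lh U + be%:P * lh V) (ga%:P * lh U + de%:P * lh V).
  have pe (x y : C) : (cst2 x * f + cst2 y * g).[c0] = x%:P * f.[c0] + y%:P * g.[c0].
    by rewrite hornerD !hornerM !ev_cst2.
  split; last first.
    rewrite -/c0 /p1 /p2 !pe; apply/eqP; rewrite -subr_eq0; apply/eqP.
    transitivity ((al%:P * de%:P - be%:P * ga%:P) * (f.[c0] * lh V - g.[c0] * lh U)); first by ring.
    by rewrite E' subrr mulr0.
  apply/eqP => h0; have /eqP : lh V * p2.[c0] = 0.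
    rewrite /p2 pe; transitivity (g.[c0] * (ga%:P * lh U + de%:P * lh V) + ga%:P * (f.[c0] * lh V - g.[c0] * lh U)).
      by ring.
    by rewrite h0 E' subrr !mulr0 addr0.
  by rewrite mulf_eq0 (negPf hV) (negPf hp2).
have slh (W : {poly C}) : (size (lh W) <= M)%N.
  rewrite /lh !mul_polyC; apply: leq_trans (size_polyD _ _) _.
  by rewrite geq_max !(leq_trans (size_scale_leq _ _)).
have slc (x y : C) : (size (x%:P * lh U + y%:P * lh V)%R <= M)%N.
  rewrite !mul_polyC; apply: leq_trans (size_polyD _ _) _.
  by rewrite geq_max !(leq_trans (size_scale_leq _ _)).
move=> a b ab b0.
have [U' [V' [c' e']]] := luroth hD hell hM FIp hp2 np rp (slc _ _) (slc _ _) ab b0.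
exists (rdeg U' V'), U', V'.
have [h h'] : (size U' <= (rdeg U' V').+1)%N /\ (size V' <= (rdeg U' V').+1)%N.
  by rewrite /rdeg; move: (size U') (size V') => x y; clear; lia.
by split=> //; apply: (hcomp_eq (ev_neq0 hp2)).
Qed.

End Indecomposable.

(** * Logarithmic forms and residues *)

Section LogForms.
Variable C : numClosedFieldType.
Local Notation R := {poly {poly C}}.
Implicit Types (A B p q r t a b c : R).

(* The rational 1-form (a dX + b dY) / c is closed. *)
Definition closed_form a b c :=
  c * dY a - a * dY c = c * dX b - b * dX c.

Lemma closed_form1 : closed_form 0 0 1.
Proof.
rewrite /closed_form (der0 (@dX_deriv C)) (der0 (@dY_deriv C)) (der1 (@dX_deriv C)).
by rewrite (der1 (@dY_deriv C)); ring.
Qed.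

(** The sum of k dq/q and (a dX + b dY)/c over the common denominator [q * c]. *)
Lemma closed_form_cons (k : C) q a b c : closed_form a b c ->
  closed_form (cst2 k * dX q * c + q * a) (cst2 k * dY q * c + q * b) (q * c).
Proof.
rewrite /closed_form => h.
have hX := @dX_deriv C; have hY := @dY_deriv C.
rewrite !(derD hX) !(derD hY) !(derM hX) !(derM hY) (derC hX) (derC hY) dXY.
pose sym := cst2 k * q * c ^+ 2 * dY (dX q) - cst2 k * dX q * dY q * c ^+ 2.
transitivity (sym + q ^+ 2 * (c * dY a - a * dY c)); first by rewrite /sym; ring.
by rewrite h /sym; ring.
Qed.

Section LogSum.
Variables (I : eqType) (k : I -> C) (q : I -> R).

Definition log_den (s : seq I) := \prod_(i <- s) q i.

(** The numerator of \sum_i k_i d(q_i)/q_i over [log_den s]; taking [dX], [dY] or D for [d] gives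
    the two components of the form and its value on D. *)
Fixpoint log_num (d : R -> R) (s : seq I) : R :=
  if s is i :: s' then cst2 (k i) * d (q i) * log_den s' + q i * log_num d s' else 0.

Lemma log_den_cons i s : log_den (i :: s) = q i * log_den s.
Proof. by rewrite /log_den big_cons. Qed.

Lemma log_closed s : closed_form (log_num (@dX C) s) (log_num (@dY C) s) (log_den s).
Proof.
elim: s => [|i s IH] /=; first by rewrite /log_den big_nil; apply: closed_form1.
by rewrite log_den_cons; apply: closed_form_cons.
Qed.

Lemma log_num_derivation A B s :
  A * log_num (@dX C) s + B * log_num (@dY C) s = log_num (derivation A B) s.
Proof.
elim: s => [|i s IH] /=; first by rewrite !mulr0 addr0.
by rewrite -IH /derivation; ring.
Qed.

Lemma log_num_cofactor A B (L : I -> R) s :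
  (forall i, derivation A B (q i) = L i * q i) ->
  log_num (derivation A B) s = log_den s * \sum_(i <- s) cst2 (k i) * L i.
Proof.
move=> h; elim: s => [|i s IH] /=; first by rewrite big_nil mulr0.
by rewrite IH h log_den_cons big_cons; ring.
Qed.

End LogSum.

(** [wronsk d p r] over [p * r] is the logarithmic derivative of p/r. *)
Definition wronsk (d : R -> R) p r := d p * r - p * d r.

Lemma wronsk_closed p r :
  closed_form (wronsk (@dX C) p r) (wronsk (@dY C) p r) (p * r).
Proof.
have := closed_form_cons 1 p (closed_form_cons (-1) r closed_form1).
rewrite cst2N cst21 !mulr1 !mulr0 !mul1r !addr0 !mulN1r.
by rewrite /wronsk !mulrN.
Qed.

Lemma wronsk_derivation A B p r :
  A * wronsk (@dX C) p r + B * wronsk (@dY C) p r = wronsk (derivation A B) p r.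
Proof. by rewrite /wronsk /derivation; ring. Qed.

(** The derivative of A a + B b = 0 in Y, combined with closedness, eliminates [a]. *)
Lemma closed_form_logder A B a b c : closed_form a b c -> A * a + B * b = 0 ->
  A * (c * derivation A B b - b * derivation A B c) = c * b * (B * dY A - A * dY B).
Proof.
have hY := @dY_deriv C.
rewrite /closed_form => h2 h0; have := congr1 (@dY C) h0.
rewrite (derD hY) !(derM hY) (der0 hY) => h1.
apply/eqP; rewrite -subr_eq0; apply/eqP; rewrite /derivation.
transitivity (A ^+ 2 * ((c * dX b - b * dX c) - (c * dY a - a * dY c)) +
  A * c * (dY A * a + A * dY a + (dY B * b + B * dY b)) - (A * dY c + c * dY A) * (A * a + B * b)).
  by ring.
by rewrite h0 h1 h2 subrr !mulr0 subr0 addr0.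
Qed.

Lemma closed_form_logder' A B a b c : closed_form a b c -> A * a + B * b = 0 ->
  B * (c * derivation A B a - a * derivation A B c) = c * a * (A * dX B - B * dX A).
Proof.
have hX := @dX_deriv C.
rewrite /closed_form => h2 h0; have := congr1 (@dX C) h0.
rewrite (derD hX) !(derM hX) (der0 hX) => h1.
apply/eqP; rewrite -subr_eq0; apply/eqP; rewrite /derivation.
transitivity (B ^+ 2 * ((c * dY a - a * dY c) - (c * dX b - b * dX c)) +
  B * c * (dX A * a + A * dX a + (dX B * b + B * dX b)) - (B * dX c + c * dX B) * (A * a + B * b)).
  by ring.
by rewrite h0 h1 h2 subrr !mulr0 subr0 addr0.
Qed.

(* For every closed form (a dX + b dY)/c annihilated by D, the logarithmic derivative D(b/c)/(b/c)
   is (B dY A - A dY B)/A; it does not depend on the form. *)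
Lemma closed_form_ratio A B a b c a' b' c' (D := derivation A B) :
  closed_form a b c -> A * a + B * b = 0 ->
  closed_form a' b' c' -> A * a' + B * b' = 0 ->
  (A != 0 -> first_int D (b * c') (b' * c)) /\ (B != 0 -> first_int D (a * c') (a' * c)).
Proof.
have hD : is_deriv D by apply: derivation_deriv.
move=> cl h cl' h'; split=> n0; rewrite /first_int !(derM hD);
  apply: (mulfI n0); apply/eqP; rewrite -subr_eq0; apply/eqP.
  have e := closed_form_logder cl h; have e' := closed_form_logder cl' h'.
  transitivity (c' * b' * (A * (c * D b - b * D c)) - c * b * (A * (c' * D b' - b' * D c'))).
    by ring.
  by rewrite e e'; ring.
have e := closed_form_logder' cl h; have e' := closed_form_logder' cl' h'.
transitivity (c' * a' * (B * (c * D a - a * D c)) - c * a * (B * (c' * D a' - a' * D c'))).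
  by ring.
by rewrite e e'; ring.
Qed.

Lemma dvdr_dY q : dvdr q (dY q) -> dY q = 0.
Proof.
move=> [r e]; have [q0|q0] := eqVneq q 0; first by rewrite q0 (der0 (@dY_deriv C)).
have [r0|r0] := eqVneq r 0; first by rewrite e r0 mul0r.
have := lt_size_deriv q0; rewrite -/(dY q) e size_mul //.
by move: r0; rewrite -size_poly_gt0; move: (size r) (size q) => x z; clear; lia.
Qed.

Lemma swapXY_dX q : swapXY (dX q) = dY (swapXY q).
Proof.
apply: poly2P => i j; rewrite coef2_dY /coef2 !coef_swapXY -/(coef2 _ _ _) coef2_dX.
by [].
Qed.

Lemma dvdr_dX q : dvdr q (dX q) -> dX q = 0.
Proof.
move=> [r e]; apply/eqP; rewrite -swapXY_eq0 swapXY_dX; apply/eqP; apply: dvdr_dY.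
by exists (swapXY r); rewrite -swapXY_dX e rmorphM.
Qed.

Lemma cst2_unit (c : C) : c != 0 -> cst2 c \is a GRing.unit.
Proof. by move=> c0; rewrite /cst2 !unit_polyC // unitfE. Qed.

Lemma primer_cst2 q (c : C) : primer q -> dvdr q (cst2 c) -> c = 0.
Proof.
move=> pq h; apply/eqP/contraT => /cst2_unit u.
by case: (primer_ndvd_unit pq u h).
Qed.

(** By degree, a partial derivative divisible by [q] vanishes; if both vanish, [q] is constant in
    characteristic 0. *)
Lemma primer_partial q : primer q -> ~ dvdr q (dX q) \/ ~ dvdr q (dY q).
Proof.
move=> [q0 qu _]; apply: NNPP => h.
have hX : dX q = 0 by apply: dvdr_dX; apply: NNPP => h'; apply: h; left.
have hY : dY q = 0 by apply: dvdr_dY; apply: NNPP => h'; apply: h; right.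
have hx i j : coef2 q i.+1 j = 0.
  have /esym/eqP := coef2_dX q i j; rewrite hX /coef2 !coef0 mulrn_eq0.
  by move=> /eqP.
have hy i j : coef2 q i j.+1 = 0.
  have /esym/eqP := coef2_dY q i j; rewrite hY /coef2 !coef0 mulrn_eq0.
  by move=> /eqP.
have eq : q = cst2 (coef2 q 0 0).
  apply: poly2P => i j; rewrite {2}/coef2 /cst2 coefC; case: j => [|j].
    by rewrite coefC; case: i => [|i].
  by rewrite coef0 hy.
move: qu; rewrite eq cst2_unit //; apply: contraNneq q0 => e; rewrite eq e cst20 //.
Qed.

(** The measure is the size in Y plus the size in X of the leading coefficient. The two degrees
    behind it are additive under products, and their sum is positive for a nonunit [q]. *)
Lemma primer_mult q p : primer q -> p != 0 ->
  exists e t, p = q ^+ e * t /\ ~ dvdr q t.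
Proof.
move=> [q0 qu _]; move: {2}(size p + size (lead_coef p))%N (leqnn (size p + size (lead_coef p))) => n.
elim: n p => [|n IH] p hn p0.
  by move: hn p0; rewrite leqn0 addn_eq0 size_poly_eq0 => /andP[->].
have [[t et]|h] := classic (dvdr q p); last by exists 0%N, p; rewrite expr0 mul1r.
have t0 : t != 0 by apply: contraNneq p0 => h; rewrite et h mul0r.
have [|e [t' [et' ht']]] := IH t _ t0; last first.
  by exists e.+1, t'; rewrite et {1}et' exprS; split=> //; ring.
have : (2 < size q + size (lead_coef q))%N.
  rewrite ltnNge; apply: contra qu => h.
  have l0 : lead_coef q != 0 by rewrite lead_coef_eq0.
  have s1 : (0 < size q)%N by rewrite size_poly_gt0.
  have s2 : (0 < size (lead_coef q))%N by rewrite size_poly_gt0.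
  have e1 : size q = 1%N by move: h s1 s2; clear; lia.
  have e2 : size (lead_coef q) = 1%N by move: h s1 s2; clear; lia.
  move: e2; rewrite lead_coefE e1 /= => /eqP/size_poly1P[c c0 ec].
  by rewrite (size1_polyC (eq_leq e1)) ec; apply: cst2_unit.
move: hn; rewrite et lead_coefM !size_mul ?lead_coef_eq0 //.
have s1 : (0 < size q)%N by rewrite size_poly_gt0.
have s2 : (0 < size (lead_coef q))%N by rewrite size_poly_gt0 lead_coef_eq0.
move: s1 s2; move: (size q) (size t) (size (lead_coef q)) (size (lead_coef t)) => x y z w.
by clear; lia.
Qed.

Lemma derXS (D : R -> R) q n : is_deriv D -> q != 0 ->
  D (q ^+ n.+1) = cst2 n.+1%:R * q ^+ n * D q.
Proof.
move=> hD q0; apply: (mulfI q0); rewrite (derX hD) exprS.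
have -> : cst2 (n.+1%:R : C) = n.+1%:R by rewrite /cst2 !polyC_natr.
by ring.
Qed.

(** In D(p)/p = D(x)/x the right side has no pole along [q], while the left side has the polar part
    e D(q)/q, with e > 0 the multiplicity of [q] in [p]. *)
Lemma darboux_factor (D : R -> R) q p x : is_deriv D -> primer q -> p != 0 ->
  dvdr q p -> ~ dvdr q x -> first_int D p x -> dvdr q (D q).
Proof.
move=> hD pq p0 qp qx; have [q0 _ _] := pq.
have [[|e] [t [et qt]]] := primer_mult pq p0; first by case: qt; rewrite -(mul1r t) -(expr0 q) -et.
rewrite /first_int et (derM hD) (derXS _ hD q0) => h.
have h' : x * cst2 e.+1%:R * t * D q = (t * D x - x * D t) * q.
  apply: (mulfI (expf_neq0 e q0)); move: h; rewrite exprS => /eqP.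
  rewrite -subr_eq0 => /eqP h; apply/eqP; rewrite -subr_eq0 -h; apply/eqP; ring.
have := ex_intro _ _ h' : dvdr q _; rewrite -!mulrA.
move/(primer_dvd_mul pq qx)/(primer_dvd_mul pq _); case=> [/(primer_cst2 pq)/eqP|].
  by rewrite pnatr_eq0.
by move=> r er; apply: (primer_dvd_mul pq qt); exists r.
Qed.

Lemma hcomp_mod n (V : {poly C}) p r : exists w, hcomp n V p r = cst2 V`_0 * r ^+ n + w * p.
Proof.
rewrite /hcomp; case es : (size V) => [|m].
  by exists 0; rewrite big_ord0 nth_default ?es // cst20 !mul0r addr0.
exists (\sum_(i < m) cst2 V`_i.+1 * p ^+ i * r ^+ (n - i.+1)).
rewrite big_ord_recl expr0 mulr1 subn0 mulr_suml; congr (_ + _).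
by apply: eq_bigr => i _; rewrite lift0 exprS; ring.
Qed.

Lemma wronsk_expand (D : R -> R) q e t r : is_deriv D -> q != 0 -> exists w,
  wronsk D (q ^+ e.+1 * t) r = q ^+ e * (cst2 e.+1%:R * t * r * D q + w * q).
Proof.
move=> hD q0; exists (D t * r - t * D r).
by rewrite /wronsk (derM hD) (derXS _ hD q0) exprS; ring.
Qed.

(* Comparison of the residues along q of N/(q P) and U(p/r)/V(p/r) dlog(p/r), where c is the
   residue of the former. *)
Lemma residue_pole (d : R -> R) q e t r P N' n (U V : {poly C}) (c : C) (p := q ^+ e.+1 * t) :
  is_deriv d -> primer q -> ~ dvdr q t -> ~ dvdr q r -> ~ dvdr q P -> ~ dvdr q (d q) ->
  wronsk d p r * (q * P) * hcomp n U p r =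
    (cst2 c * d q * P + q * N') * (p * r) * hcomp n V p r ->
  e.+1%:R * U`_0 = c * V`_0.
Proof.
move=> hd pq qt qr qP qd; have [q0 _ _] := pq; rewrite /p.
have [w ->] := wronsk_expand e t r hd q0.
have [u ->] := hcomp_mod n U (q ^+ e.+1 * t) r; have [v ->] := hcomp_mod n V (q ^+ e.+1 * t) r.
move=> h; apply/eqP; rewrite -subr_eq0; apply/eqP/(primer_cst2 pq).
rewrite cst2D cst2N !cst2M.
apply: (primer_dvd_mul pq qP); apply: (primer_dvd_mul pq qt).
apply: (primer_dvd_mul pq qd); apply: (primer_dvd_mul pq (a := r ^+ n.+1)).
  by move/(primer_dvd_exp pq).
exists (N' * t * r * (cst2 V`_0 * r ^+ n + v * (q ^+ e.+1 * t)) -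
  w * P * (cst2 U`_0 * r ^+ n + u * (q ^+ e.+1 * t)) +
  (cst2 c * v - cst2 e.+1%:R * u) * d q * P * t * r * (q ^+ e * t)).
apply: (mulfI (expf_neq0 e.+1 q0)); move/eqP: h; rewrite -subr_eq0 => /eqP h.
apply/eqP; rewrite -subr_eq0 -h !exprS; apply/eqP.
move: (q ^+ e) (r ^+ n) (cst2 _) (cst2 _) (cst2 _) (cst2 _) => Q r' k1 k2 k3 k4.
by ring.
Qed.

(** The case of a form N/P without pole along [q]: its residue 0 must equal the residue of
    U(p/r)/V(p/r) dlog(p/r). *)
Lemma residue_regular (d : R -> R) q e t r P N n (U V : {poly C}) (p := q ^+ e.+1 * t) :
  is_deriv d -> primer q -> ~ dvdr q t -> ~ dvdr q r -> ~ dvdr q P -> ~ dvdr q (d q) ->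
  wronsk d p r * P * hcomp n U p r = N * (p * r) * hcomp n V p r ->
  U`_0 = 0.
Proof.
move=> hd pq qt qr qP qd; have [q0 _ _] := pq; rewrite /p.
have [w ->] := wronsk_expand e t r hd q0.
have [u ->] := hcomp_mod n U (q ^+ e.+1 * t) r; have [v ->] := hcomp_mod n V (q ^+ e.+1 * t) r.
move=> h; apply/eqP; suff : e.+1%:R * U`_0 == 0 :> C by rewrite mulf_eq0 pnatr_eq0.
apply/eqP/(primer_cst2 pq); rewrite cst2M.
apply: (primer_dvd_mul pq qP); apply: (primer_dvd_mul pq qt).
apply: (primer_dvd_mul pq qd); apply: (primer_dvd_mul pq (a := r ^+ n.+1)).
  by move/(primer_dvd_exp pq).
exists (N * t * r * (cst2 V`_0 * r ^+ n + v * (q ^+ e.+1 * t)) -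
  w * P * (cst2 U`_0 * r ^+ n + u * (q ^+ e.+1 * t)) -
  cst2 e.+1%:R * u * d q * P * t * r * (q ^+ e * t)).
apply: (mulfI (expf_neq0 e q0)); move/eqP: h; rewrite -subr_eq0 => /eqP h.
apply/eqP; rewrite -subr_eq0 -h !exprS; apply/eqP.
move: (q ^+ e) (r ^+ n) (cst2 _) (cst2 _) (cst2 _) => Q r' k1 k2 k3.
by ring.
Qed.

End LogForms.

(** * The number of kept factors is at most the number of lattice points *)

Section Core.
Variable C : numClosedFieldType.
Local Notation R := {poly {poly C}}.
Implicit Types (A B f g : R).

Lemma coprime_prime f g q : coprime2 f g -> primer q -> dvdr q f -> dvdr q g -> False.
Proof.
move=> cop [q0 /negP qu _] qf qg; have [c c0 e] := cop q qf qg.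
by apply: qu; rewrite e cst2_unit.
Qed.

Lemma primer_cst2_mul (c : C) q p : primer q -> c != 0 -> dvdr q (cst2 c * p) -> dvdr q p.
Proof. by move=> pq c0; apply: primer_dvd_mul => // /(primer_cst2 pq)/eqP; rewrite (negPf c0). Qed.

Lemma pencil_prime f g q (l m l' m' : C) : coprime2 f g -> primer q ->
  l * m' != l' * m -> dvdr q (cst2 l * f - cst2 m * g) -> ~ dvdr q (cst2 l' * f - cst2 m' * g).
Proof.
move=> cop pq det h h'.
have d0 : l' * m - l * m' != 0 by rewrite subr_eq0 eq_sym.
apply: (coprime_prime cop pq); apply: (primer_cst2_mul pq d0).
  have -> : cst2 (l' * m - l * m') * f =
      cst2 m * (cst2 l' * f - cst2 m' * g) - cst2 m' * (cst2 l * f - cst2 m * g).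
    by rewrite cst2D cst2N !cst2M; ring.
  by apply: dvdr_sub; apply: dvdr_mull.
have -> : cst2 (l' * m - l * m') * g =
    cst2 l * (cst2 l' * f - cst2 m' * g) - cst2 l' * (cst2 l * f - cst2 m * g).
  by rewrite cst2D cst2N !cst2M; ring.
by apply: dvdr_sub; apply: dvdr_mull.
Qed.

Lemma pencil_neq0 f g (l m : C) : g != 0 -> ~ const_ratio f g ->
  (l != 0) || (m != 0) -> cst2 l * f - cst2 m * g != 0.
Proof.
move=> g0 nc lm; have n : nonconst f g by move=> c e; apply: nc; exists c.
have := nonconst_comb g0 n (_ : (m != 0) || (l != 0)); rewrite orbC lm => /(_ isT).
by rewrite -oppr_eq0 opprB.
Qed.

(* Otherwise some form w = \sum_i c_i dq_i/q_i with c_k <> 0 satisfies w(D) = 0. For p the pencil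
   member divisible by q_k and r another one, w = H dlog(p/r) with H a first integral, so H = U/V
   at p/r. As p/r vanishes along both q_k and b_k, comparing residues there gives U(0)/V(0) != 0
   and U(0)/V(0) = 0. *)
Lemma cofactor_count A B f g (x y : C) (N : nat) (q b : 'I_N -> R) (l m : 'I_N -> C) :
  (A != 0) || (B != 0) -> first_int (derivation A B) f g -> g != 0 ->
  coprime2 f g -> ~ const_ratio f g -> ~ decomposable f g -> lgeneric A B x y ->
  (forall i, (l i != 0) || (m i != 0)) ->
  (forall i, primer (q i) /\ dvdr (q i) (cst2 (l i) * f - cst2 (m i) * g)) ->
  (forall i, primer (b i) /\ dvdr (b i) (cst2 (l i) * f - cst2 (m i) * g)) ->
  (forall i j, i != j -> ~ dvdr (q i) (q j)) -> (forall i j, ~ dvdr (b i) (q j)) ->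
  (N <= newtonB A B x y)%N.
Proof.
move=> AB fg g0 cop nc ndec gen lm hq hb qq bq; rewrite leqNgt; apply/negP => hN.
have hD : is_deriv (derivation A B) by apply: derivation_deriv.
set D := derivation A B in fg hD.
have p0 i : cst2 (l i) * f - cst2 (m i) * g != 0 by apply: pencil_neq0.
have ndfg i : ~ dvdr (q i) f \/ ~ dvdr (q i) g.
  apply: NNPP => h; apply: (coprime_prime cop (proj1 (hq i))); apply: NNPP => h'; apply: h; by [left|right].
have gf : first_int D g f by apply: FI_sym.
have FIp i z : first_int D f z -> first_int D g z -> first_int D (cst2 (l i) * f - cst2 (m i) * g) z.
  by move=> h h'; apply: FIB => //; apply: FIC.
have hL i : dvdr (q i) (D (q i)).
  have [pq qp] := hq i.
  by case: (ndfg i) => h; apply: (darboux_factor hD pq (p0 i) qp h); apply: FIp.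
pose L i := proj1_sig (constructive_indefinite_description _ (hL i)).
have eL i : D (q i) = L i * q i by rewrite /L; case: constructive_indefinite_description.
have q0 i : q i != 0 by case: (hq i) => -[].
have [c [[k ck] rel]] := cofactor_dependent gen q0 eL hN.
(* With [k] listed first, the form splits as c_k dq_k/q_k plus a rest without pole along [q k], the
   shape that [residue_pole] needs. *)
pose s' := rem k (index_enum 'I_N).
have ps : perm_eq (index_enum 'I_N) (k :: s') by apply: perm_to_rem; rewrite mem_index_enum.
pose s := k :: s'.
have qs' : ~ dvdr (q k) (log_den q s').
  rewrite /log_den => h.
  have : exists2 i, i \in s' & dvdr (q k) (q i).
    have [pq _] := hq k; have := h; rewrite -(big_map q xpredT id) => /(primer_dvd_prod pq)[_ /mapP[i is' ->]].
    by exists i.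
  move=> [i]; rewrite /s' mem_rem_uniq ?index_enum_uniq // inE eq_sym => /andP[h1 _].
  exact: qq.
have bs : ~ dvdr (b k) (log_den q s).
  rewrite /log_den -(big_map q xpredT id) => /(primer_dvd_prod (proj1 (hb k)))[_ /mapP[i is' ->]].
  exact: bq.
have Dnum : log_num c q D s = 0.
  rewrite (log_num_cofactor c s eL) (_ : \sum_(i <- s) _ = 0) ?mulr0 // -[RHS]rel.
  by apply/esym; apply: perm_big.
set NX := log_num c q (@dX C) s; set NY := log_num c q (@dY C) s.
have hN0 : A * NX + B * NY = 0 by rewrite log_num_derivation.
have clN := log_closed c q s.
pose p := cst2 (l k) * f - cst2 (m k) * g.
(* [p] and [r] must span the pencil; [p] is a multiple of [g] exactly when [l k = 0]. *)
pose r := if l k == 0 then f else g.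
have fi_pr : first_int D p r by rewrite /r; case: ifP => _; apply: FIp.
set WX := wronsk (@dX C) p r; set WY := wronsk (@dY C) p r.
have hW0 : A * WX + B * WY = 0.
  by rewrite wronsk_derivation /wronsk -/D; move: fi_pr; rewrite /first_int mulrC => ->; rewrite subrr.
have clW := wronsk_closed p r.
have pr0 : p != 0 by apply: p0.
have r0 : r != 0.
  rewrite /r; case: ifP => // _; apply/eqP => f0; apply: nc; exists 0; rewrite cst20 mul0r //.
have hfact z : primer z -> dvdr z p -> ~ dvdr z r.
  move=> pz; rewrite /r /p; case: eqP => [lk|/eqP lk] h h'.
    have mk : - m k != 0 by have := lm k; rewrite lk eqxx oppr_eq0.
    apply: (coprime_prime cop pz h'); apply: (primer_cst2_mul pz mk).
    by move: h; rewrite lk cst20 mul0r sub0r cst2N mulNr.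
  apply: (coprime_prime cop pz _ h'); apply: (primer_cst2_mul pz lk).
  by apply: dvdr_addl h; apply: dvdr_opp; apply: dvdr_mull.
have hX := @dX_deriv C; have hY := @dY_deriv C.
have split_prime z : primer z -> dvdr z p -> exists e t, p = z ^+ e.+1 * t /\ ~ dvdr z t.
  move=> pz zp; have [[|e] [t [et zt]]] := primer_mult pz pr0; last by exists e, t.
  by case: zt; rewrite -(mul1r t) -(expr0 z) -et.
have [pq qp] := hq k; have [e [t [ep qt]]] := split_prime _ pq qp.
have [pb bp] := hb k; have [e' [t' [ep' bt]]] := split_prime _ pb bp.
have qr := hfact _ pq qp; have br := hfact _ pb bp.
have wnz d : is_deriv d -> ~ dvdr (q k) (d (q k)) -> wronsk d p r != 0.
  move=> hd nd; apply/eqP; rewrite ep; have [w ->] := wronsk_expand e t r hd (q0 k).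
  move=> /eqP; rewrite mulf_eq0 expf_eq0 (negPf (q0 k)) andbF /= addr_eq0 => /eqP h.
  apply: nd; apply: (primer_dvd_mul pq qr); apply: (primer_dvd_mul pq qt).
  apply: (primer_cst2_mul pq (_ : e.+1%:R != 0)); first by rewrite pnatr_eq0.
  by exists (- w); rewrite mulNr -h; ring.
have den0 : log_den q s != 0.
  by rewrite /log_den prodf_seq_neq0; apply/allP => i _; exact: q0.
have wX : A != 0 -> WY != 0.
  move=> A0; apply/eqP => w0; move/eqP: hW0; rewrite w0 mulr0 addr0 mulf_eq0 (negPf A0) /= => h.
  case: (primer_partial pq) => h'; first by have := wnz _ hX h'; rewrite h.
  by have := wnz _ hY h'; rewrite -/WY w0 eqxx.
have wY : B != 0 -> WX != 0.
  move=> B0; apply/eqP => w0; move/eqP: hW0; rewrite w0 mulr0 add0r mulf_eq0 (negPf B0) /= => h.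
  case: (primer_partial pq) => h'; first by have := wnz _ hX h'; rewrite -/WX w0 eqxx.
  by have := wnz _ hY h'; rewrite h.
have [Ha Hb] := closed_form_ratio clN hN0 clW hW0.
have nfg : nonconst f g by move=> z ez; apply: nc; exists z.
have field a z : first_int D a z -> z != 0 -> exists n U V,
    coprimep U V /\ z * hcomp n U p r = a * hcomp n V p r.
  move=> faz z0.
  have det : l k * (l k != 0)%:R - (- m k) * (l k == 0)%:R != 0.
    have := lm k; case: (eqVneq (l k) 0) => [lk|lk] /=.
      by rewrite mulr0 mulr1 sub0r opprK.
    move=> _.
    by rewrite mulr1 mulr0 subr0.
  have [n [U [V [h1 _ _ h2]]]] := indecomposable_field AB fg g0 nfg ndec det faz z0.
  exists n, U, V; split=> //; move: h2.
  have -> : cst2 (l k) * f + cst2 (- m k) * g = p by rewrite cst2N mulNr.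
  suff -> : cst2 (l k == 0)%:R * f + cst2 (l k != 0)%:R * g = r by [].
  by rewrite /r; case: eqP => _ /=; rewrite cst20 cst21; ring.
have [n [U [V [cUV EX EY]]]] : exists n U V, [/\ coprimep U V,
    WX * log_den q s * hcomp n U p r = NX * (p * r) * hcomp n V p r &
    WY * log_den q s * hcomp n U p r = NY * (p * r) * hcomp n V p r].
  (* H is taken as the ratio of the dY components if A is nonzero, of the dX components otherwise.
     The other components have the same ratio because both forms annihilate D. *)
  have [A0|A0] := eqVneq A 0.
    have B0 : B != 0 by move: AB; rewrite A0 eqxx.
    have [n [U [V [h1 h2]]]] := field _ _ (Hb B0) (mulf_neq0 (wY B0) den0).
    exists n, U, V; split=> //; apply: (mulfI B0).
    have eW : B * WY = - (A * WX) by apply/eqP; rewrite -addr_eq0 addrC hW0.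
    have eN : B * NY = - (A * NX) by apply/eqP; rewrite -addr_eq0 addrC hN0.
    transitivity ((B * WY) * (log_den q s * hcomp n U p r)); first by ring.
    rewrite eW; transitivity (- A * (WX * log_den q s * hcomp n U p r)); first by ring.
    rewrite h2 -/NX; transitivity (- (A * NX) * (p * r * hcomp n V p r)); first by ring.
    by rewrite -eN; ring.
  have [n [U [V [h1 h2]]]] := field _ _ (Ha A0) (mulf_neq0 (wX A0) den0).
  exists n, U, V; split=> //; apply: (mulfI A0).
  have eW : A * WX = - (B * WY) by apply/eqP; rewrite -addr_eq0 hW0.
  have eN : A * NX = - (B * NY) by apply/eqP; rewrite -addr_eq0 hN0.
  transitivity ((A * WX) * (log_den q s * hcomp n U p r)); first by ring.
  rewrite eW; transitivity (- B * (WY * log_den q s * hcomp n U p r)); first by ring.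
  rewrite h2 -/NY; transitivity (- (B * NY) * (p * r * hcomp n V p r)); first by ring.
  by rewrite -eN; ring.
(* [b k] divides [p] but not the denominator of the form; the component used is one whose partial
   derivative of [b k] is not divisible by [b k]. *)
have U0 : U`_0 = 0.
  case: (primer_partial pb) => nd.
    by move: EX; rewrite /WX ep' => /(residue_regular hX pb bt br bs nd).
  by move: EY; rewrite /WY ep' => /(residue_regular hY pb bt br bs nd).
have eV : e.+1%:R * U`_0 = c k * V`_0.
  case: (primer_partial pq) => nd.
    by move: EX; rewrite /WX /NX ep log_den_cons => /(residue_pole hX pq qt qr qs' nd).
  by move: EY; rewrite /WY /NY ep log_den_cons => /(residue_pole hY pq qt qr qs' nd).
have V0 : V`_0 = 0.
  by apply/eqP; move/esym/eqP: eV; rewrite U0 mulr0 mulf_eq0 (negPf ck).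
have := coprimep_root cUV (_ : root U 0); rewrite !rootE -!horner_coef0 in U0 V0 *.
by rewrite U0 V0 eqxx => /(_ isT).
Qed.

End Core.
(** * Dehomogenization *)

Section MonomialDivisor.
Variable S : idomainType.

(** Once the powers of the variable are removed, the cofactors of [P] and [Q] do not vanish at 0, so
    their product is a constant, and so is each of them. *)
Lemma monomial_divisor (P Q : {poly S}) (c : S) n : c != 0 -> P * Q = c *: 'X^n ->
  exists a k, P = a *: 'X^k.
Proof.
move=> c0 e.
have n0 : P * Q != 0 by rewrite e -mul_polyC mulf_neq0 ?polyC_eq0 // monic_neq0 // monicXn.
have [P0 Q0] : P != 0 /\ Q != 0 by apply/andP; rewrite -negb_or -mulf_eq0.
have [a [P' rP eP]] := multiplicity_XsubC P 0; have [b [Q' rQ eQ]] := multiplicity_XsubC Q 0.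
rewrite P0 /= in rP; rewrite Q0 /= in rQ; rewrite subr0 in eP eQ.
have PQ0 : (P' * Q').[0] != 0 by rewrite hornerM mulf_neq0 // -rootE.
have e' : P' * Q' * 'X^(a + b) = c *: 'X^n by rewrite -e eP eQ exprD; ring.
have X0 k : 'X^k != 0 :> {poly S} by rewrite monic_neq0 // monicXn.
have nab : n = (a + b)%N.
  case: (ltngtP n (a + b)) => // h.
    move: e'; rewrite -(subnK (ltnW h)) exprD mulrA -mul_polyC => /(mulIf (X0 n)).
    move/(congr1 (horner^~ 0)); rewrite hornerM hornerC hornerXn expr0n subn_eq0 leqNgt h mulr0.
    by move=> h'; rewrite -h' eqxx in c0.
  move: e'; rewrite -(subnK (ltnW h)) [X in _ = _ *: X]exprD -mul_polyC mulrA => /(mulIf (X0 _)).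
  move/(congr1 (horner^~ 0)); rewrite [RHS]hornerM hornerC hornerXn expr0n subn_eq0 leqNgt h mulr0.
  by move=> h'; rewrite h' eqxx in PQ0.
move: e'; rewrite -nab -mul_polyC => /(mulIf (X0 _)) e'.
have [P'0 Q'0] : P' != 0 /\ Q' != 0.
  by apply/andP; rewrite -negb_or -mulf_eq0; apply: contraNneq PQ0 => ->; rewrite horner0.
have : size (P' * Q') = 1%N by rewrite e' size_polyC c0.
rewrite size_mul // => hs.
have sP : (size P' <= 1)%N.
  move: hs; have : (0 < size Q')%N by rewrite size_poly_gt0.
  by move: (size P') (size Q') => x y; clear; lia.
exists P'`_0, a; rewrite eP -mul_polyC -size1_polyC //.
Qed.

End MonomialDivisor.

Section Homogeneous.
Variable C : numClosedFieldType.
Local Notation R := {poly {poly C}}.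
Local Notation T := {poly {poly {poly C}}}.
Implicit Types (f g p q : R) (G P Q : T).
Local Notation ZZ := (ZZ C).
Local Notation XX := (XX C).
Local Notation YY := (YY C).

Definition scaleX : {poly C} -> T := horner_eval (XX * ZZ) \o map_poly (polyC \o (polyC \o polyC)).
HB.instance Definition _ := GRing.RMorphism.copy scaleX
  (horner_eval (XX * ZZ) \o map_poly (polyC \o (polyC \o polyC))).

Definition scaleXY : R -> T := horner_eval (YY * ZZ) \o map_poly scaleX.
HB.instance Definition _ := GRing.RMorphism.copy scaleXY (horner_eval (YY * ZZ) \o map_poly scaleX).

(* The substitution X -> XZ, Y -> YZ, Z -> Z; it maps homogeneous polynomials of degree d to
   Z^d times polynomials in X and Y. *)
Definition alpha : T -> T := horner_eval ZZ \o map_poly scaleXY.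
HB.instance Definition _ := GRing.RMorphism.copy alpha (horner_eval ZZ \o map_poly scaleXY).

Lemma scaleXC c : scaleX c%:P = cst3 c.
Proof. by rewrite /scaleX /= map_polyC /= /horner_eval hornerC. Qed.
Lemma scaleXX : scaleX 'X = XX * ZZ.
Proof. by rewrite /scaleX /= map_polyX /= /horner_eval hornerX. Qed.
Lemma scaleXYC (p : {poly C}) : scaleXY p%:P = scaleX p.
Proof. by rewrite /scaleXY /= map_polyC /= /horner_eval hornerC. Qed.
Lemma scaleXYY : scaleXY 'X = YY * ZZ.
Proof. by rewrite /scaleXY /= map_polyX /= /horner_eval hornerX. Qed.
Lemma alphaC p : alpha p%:P = scaleXY p.
Proof. by rewrite /alpha /= map_polyC /= /horner_eval hornerC. Qed.
Lemma alphaZ : alpha ZZ = ZZ.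
Proof. by rewrite /alpha /= map_polyX /= /horner_eval hornerX. Qed.
Lemma alphaX : alpha XX = XX * ZZ.
Proof. by rewrite /XX alphaC scaleXYC scaleXX. Qed.
Lemma alphaY : alpha YY = YY * ZZ.
Proof. by rewrite /YY alphaC scaleXYY. Qed.
Lemma alpha_cst3 c : alpha (cst3 c) = cst3 c.
Proof. by rewrite /cst3 alphaC scaleXYC scaleXC. Qed.

Lemma alpha1 G : (alpha G).[1] = G.[1].
Proof.
have hX (p : {poly C}) : (scaleX p).[1] = p%:P.
  rewrite /scaleX /= /horner_eval -[_.[1]]/(horner_eval 1 _) -horner_map -map_poly_comp.
  rewrite /= /horner_eval hornerM /ZZ hornerX mulr1 /XX hornerC.
  rewrite (eq_map_poly (g := polyC \o polyC)); last by move=> x /=; rewrite /horner_eval hornerC.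
  by rewrite map_poly_comp horner_map; congr polyC; apply: comp_polyXr.
have hXY (p : R) : (scaleXY p).[1] = p.
  rewrite /scaleXY /= /horner_eval -[_.[1]]/(horner_eval 1 _) -horner_map -map_poly_comp.
  rewrite /= /horner_eval hornerM /ZZ hornerX mulr1 /YY hornerC.
  rewrite (eq_map_poly (g := polyC)); last by move=> x /=; rewrite /horner_eval hX.
  exact: comp_polyXr.
rewrite /alpha /= /horner_eval -[_.[1]]/(horner_eval 1 _) -horner_map -map_poly_comp.
rewrite /= /horner_eval hornerX (eq_map_poly (g := idfun)); last by move=> x /=; rewrite /horner_eval hXY.
by rewrite map_poly_id.
Qed.

Lemma infinite_nonroot (S : idomainType) (h : C -> S) (P : {poly S}) : injective h -> P != 0 ->
  exists2 z : C, z != 0 & P.[h z] != 0.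
Proof.
move=> hinj P0; apply: NNPP => hn.
pose rs := [seq h i.+1%:R | i <- iota 0 (size P)].
have hroot : all (root P) rs.
  apply/allP => _ /mapP[i _ ->]; rewrite rootE; apply/negPn/negP => hi.
  by apply: hn; exists i.+1%:R => //; rewrite pnatr_eq0.
have hu : uniq rs.
  rewrite map_inj_uniq ?iota_uniq // => i j /hinj/eqP.
  by rewrite eqr_nat => /eqP[].
by have := max_poly_roots P0 hroot hu; rewrite size_map size_iota ltnn.
Qed.

Definition ev3 (x y z : C) : T -> C :=
  horner_eval x \o (horner_eval y%:P \o horner_eval z%:P%:P).
HB.instance Definition _ x y z := GRing.RMorphism.copy (ev3 x y z)
  (horner_eval x \o (horner_eval y%:P \o horner_eval z%:P%:P)).

Lemma ev3E x y z G : ev3 x y z G = (G.[z%:P%:P]).[y%:P].[x].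
Proof. by []. Qed.

Lemma ev3_alpha x y z G : ev3 x y z (alpha G) = ev3 (x * z) (y * z) z G.
Proof.
have hX (p : {poly C}) : ev3 x y z (scaleX p) = p.[x * z].
  rewrite /scaleX /= {1}/horner_eval -horner_map -map_poly_comp map_poly_id; last first.
    by move=> c _; rewrite /= ev3E !hornerC.
  by congr _.[_]; rewrite /= ev3E hornerM /XX /ZZ !(hornerC, hornerX, hornerM).
have hXY (p : R) : ev3 x y z (scaleXY p) = p.[(y * z)%:P].[x * z].
  rewrite /scaleXY /= {1}/horner_eval -horner_map -map_poly_comp.
  rewrite (eq_map_poly (g := horner_eval (x * z))); last by move=> c /=; rewrite hX.
  rewrite -[_.[x * z]]/(horner_eval (x * z) _) -horner_map /= {3}/horner_eval hornerC.
  by congr _.[_]; rewrite /= ev3E hornerM /YY /ZZ !(hornerC, hornerX, hornerM).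
rewrite /alpha /= {1}/horner_eval -horner_map -map_poly_comp.
rewrite (eq_map_poly (g := horner_eval (x * z) \o horner_eval (y * z)%:P)); last first.
  by move=> c /=; rewrite hXY.
transitivity (map_poly (horner_eval (x * z) \o horner_eval (y * z)%:P) G).[z].
  by congr _.[_]; rewrite /= ev3E /ZZ hornerX !hornerC.
have e1 (P : T) : (P.[z%:P%:P]).[(y * z)%:P] = (map_poly (horner_eval (y * z)%:P) P).[z%:P].
  by rewrite -[LHS]/(horner_eval (y * z)%:P _) -horner_map /= [horner_eval _ _]hornerC.
have e2 (P : R) : P.[z%:P].[x * z] = (map_poly (horner_eval (x * z)) P).[z].
  by rewrite -[LHS]/(horner_eval (x * z) _) -horner_map /= [horner_eval _ _]hornerC.
by rewrite ev3E e1 e2 map_poly_comp.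
Qed.

(** A nonzero [G] is nonzero at some point (x, y, z) with z nonzero, and this is the value of
    [alpha G] at (x/z, y/z, z). *)
Lemma alpha_eq0 G : alpha G = 0 -> G = 0.
Proof.
move=> h; apply/eqP/contraT => G0.
have [z z0 hz] := infinite_nonroot (h := fun c => c%:P%:P) (fun _ _ e => polyC_inj (polyC_inj e)) G0.
have [y y0 hy] := infinite_nonroot (h := polyC) (@polyC_inj _) hz.
have [x x0 hx] := infinite_nonroot (h := id) (fun _ _ e => e) hy.
have := ev3_alpha (x / z) (y / z) z G; rewrite h !divfK //.
by rewrite /ev3 /= /horner_eval !horner0 => e; rewrite -e eqxx in hx.
Qed.

Lemma alpha_inj : injective alpha.
Proof. by move=> P Q e; apply/eqP; rewrite -subr_eq0; apply/eqP/alpha_eq0; rewrite rmorphB /= e subrr. Qed.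

Lemma poly2_def p : p = \sum_(j < size p) \sum_(i < size (p`_j)%R)
  cst2 (coef2 p i j) * 'X%:P ^+ i * 'X ^+ j.
Proof.
rewrite -{1}(coefK p) poly_def; apply: eq_bigr => j _.
rewrite -mul_polyC -[in LHS](coefK p`_j) poly_def rmorph_sum mulr_suml.
by apply: eq_bigr => i _; rewrite -mul_polyC rmorphM rmorphXn.
Qed.

Lemma alpha_homog d p : (tdeg p <= d)%N -> alpha (homog d p) = p *: 'X^d.
Proof.
move=> hd; rewrite /homog rmorph_sum [X in _ = X *: _]poly2_def -mul_polyC rmorph_sum mulr_suml.
apply: eq_bigr => j _; rewrite !rmorph_sum mulr_suml; apply: eq_bigr => i _.
(* The truncated exponent [d - (i + j)] is the true one only where [i + j <= d], which a nonzero
   coefficient ensures. *)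
have [->|h] := eqVneq (coef2 p i j) 0; first by rewrite /cst3 !(polyC0, cst20, mul0r, rmorph0).
rewrite !rmorphM !rmorphXn /= alpha_cst3 alphaX alphaY alphaZ.
have hij : (i + j <= d)%N := leq_trans (coef2_tdeg h) hd.
rewrite -[in RHS](subnKC hij) !exprD !exprMn /cst3 /XX /YY /ZZ /cst2.
by move: ('X ^+ i) ('X ^+ j) => a b; ring.
Qed.

(** Homogeneity as G(XZ, YZ, Z) = Z^e G(X, Y, 1), a form in which divisors can be treated as
    divisors of a monomial in Z. *)
Definition homogeneous3 G := exists e, alpha G = G.[1] *: 'X^e.

Lemma homogeneous3_neq0 G : homogeneous3 G -> G != 0 -> G.[1] != 0.
Proof.
move=> [e he]; apply: contraNneq => h; apply/eqP/alpha_eq0.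
by rewrite he h scale0r.
Qed.

Lemma homogeneous3M P Q : homogeneous3 P -> homogeneous3 Q -> homogeneous3 (P * Q).
Proof.
move=> [d hd] [e he]; exists (d + e)%N; rewrite rmorphM /= hd he hornerM exprD.
by rewrite -!mul_polyC polyCM; ring.
Qed.

Lemma homogeneous3Z : homogeneous3 ZZ.
Proof. by exists 1%N; rewrite alphaZ /ZZ hornerX scale1r expr1. Qed.

Lemma homogeneous3_dvd P Q : P != 0 -> homogeneous3 P -> dvdr Q P -> homogeneous3 Q.
Proof.
move=> P0 hP [S eS]; have hn := homogeneous3_neq0 hP P0; have [d hd] := hP.
have e : alpha Q * alpha S = P.[1] *: 'X^d by rewrite -rmorphM /= mulrC -eS.
have [a [k ak]] := monomial_divisor hn e.
exists k; rewrite ak -alpha1 ak hornerZ hornerXn expr1n mulr1 //.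
Qed.

Lemma horner_homog d p : (tdeg p <= d)%N -> (homog d p).[1] = p.
Proof. by move=> h; rewrite -alpha1 alpha_homog // hornerZ hornerXn expr1n mulr1. Qed.

Lemma homogeneous3_homog d p : (tdeg p <= d)%N -> homogeneous3 (homog d p).
Proof. by move=> h; exists d; rewrite horner_homog // alpha_homog. Qed.

(** The homogenized quotient gives the divisibility up to powers of Z, which the prime [Q] does not
    divide. *)
Lemma dehomog_dvd Q G : primer Q -> ~ dvdr Q ZZ -> homogeneous3 Q -> homogeneous3 G ->
  dvdr Q.[1] G.[1] -> dvdr Q G.
Proof.
move=> pQ nZ [e he] [d hd] [s es]; pose k := tdeg s.
have hs : alpha (homog k s) = s *: 'X^k by apply: alpha_homog.
apply: (primer_dvd_mul pQ (a := ZZ ^+ (e + k))); first by move/(primer_dvd_exp pQ).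
exists (ZZ ^+ d * homog k s); apply: alpha_inj.
rewrite !rmorphM !rmorphXn /= alphaZ hd he hs es -!mul_polyC polyCM exprD /ZZ.
by ring.
Qed.

Lemma dehomog_primer Q : primer Q -> ~ dvdr Q ZZ -> homogeneous3 Q -> primer Q.[1].
Proof.
move=> pQ nZ hQ; have [Q0 _ _] := pQ; split; first exact: homogeneous3_neq0.
  apply/negP => u; apply: (nZ); apply: (dehomog_dvd pQ nZ hQ homogeneous3Z).
  by rewrite /ZZ hornerX; exists (Q.[1])^-1; rewrite mulVr.
move=> a b h.
have hh p : homogeneous3 (homog (tdeg p) p) by apply: homogeneous3_homog.
have : dvdr Q (homog (tdeg a) a * homog (tdeg b) b).
  by apply: (dehomog_dvd pQ nZ hQ (homogeneous3M (hh a) (hh b))); rewrite hornerM !horner_homog.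
have ev p : dvdr Q (homog (tdeg p) p) -> dvdr Q.[1] p.
  move=> [S eS]; exists S.[1]; rewrite -hornerM -eS horner_homog //.
by move=> /(primer_or pQ)[/ev|/ev]; [left|right].
Qed.

Lemma alpha_pencil f g l m : alpha (pencil f g l m) =
  (cst2 l * f - cst2 m * g) *: 'X^(maxn (tdeg f) (tdeg g)).
Proof.
rewrite /pencil rmorphB !rmorphM /= !alpha_cst3 !alpha_homog ?leq_maxl ?leq_maxr //.
by rewrite -!mul_polyC polyCB !polyCM /cst3 /cst2; ring.
Qed.

Lemma horner_pencil f g l m : (pencil f g l m).[1] = cst2 l * f - cst2 m * g.
Proof. by rewrite -alpha1 alpha_pencil hornerZ hornerXn expr1n mulr1. Qed.

Lemma homogeneous3_pencil f g l m : homogeneous3 (pencil f g l m).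
Proof. by eexists; rewrite horner_pencil alpha_pencil. Qed.

Lemma ZZ_primer : primer ZZ.
Proof.
split; first by rewrite polyX_eq0.
  by rewrite poly_unitE size_polyX.
have dv (a : T) : a.[0] = 0 -> dvdr ZZ a.
  by move=> /eqP/factor_theorem[r ->]; exists r; rewrite subr0.
move=> a b [r er]; have : (a * b).[0] = 0 by rewrite er hornerM /ZZ hornerX mulr0.
rewrite hornerM => /eqP; rewrite mulf_eq0 => /orP[/eqP/dv|/eqP/dv]; by [left|right].
Qed.

Lemma tdeg_attained p : (0 < tdeg p)%N -> exists i j, coef2 p i j != 0 /\ (i + j)%N = tdeg p.
Proof.
move=> h; have hc : (0 < #|[pred j : 'I_(size p) | (p`_j != 0)%R]|)%N.
  rewrite lt0n; apply: contraTneq h => /card0_eq e; rewrite /tdeg big_pred0 //.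
have [j jp e] := eq_bigmax_cond (fun j : 'I_(size p) => ((size (p`_j)%R).-1 + j)%N) hc.
exists (size p`_j).-1, j; split; last by rewrite /tdeg -e.
by rewrite /coef2 -/(lead_coef _) lead_coef_eq0.
Qed.

Lemma ZZ_ndvd_homog d p : (0 < d)%N -> tdeg p = d -> ~ dvdr ZZ (homog d p).
Proof.
move=> d0 ed [r /(congr1 (horner^~ 0))]; rewrite hornerM /ZZ hornerX mulr0.
have [i [j [h eij]]] : exists i j, coef2 p i j != 0 /\ (i + j)%N = d by rewrite -ed; apply: tdeg_attained; rewrite ed.
have -> : (homog d p).[0] = \poly_(j < size p) \poly_(i < size p`_j) (coef2 p i j * 0 ^+ (d - (i + j))).
  rewrite /homog horner_sum poly_def; apply: eq_bigr => b _.
  rewrite horner_sum -mul_polyC poly_def rmorph_sum mulr_suml; apply: eq_bigr => a _.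
  rewrite !hornerM !hornerXn /cst3 /XX /YY !horner_exp !hornerC -mul_polyC !rmorphM !rmorphXn rmorph0.
  ring.
have hj : (j < size p)%N.
  by rewrite ltnNge; apply: contra h => hh; rewrite /coef2 (nth_default 0 hh) coef0.
have hi : (i < size (p`_j)%R)%N.
  by rewrite ltnNge; apply: contra h => hh; rewrite /coef2 (nth_default 0 hh).
move/(congr1 (fun q : R => coef2 q i j)); rewrite {1}/coef2 coef_poly hj coef_poly hi eij subnn expr0 mulr1.
by rewrite /coef2 !coef0 => e; move: h; rewrite /coef2 e eqxx.
Qed.

(** Two distinct members generate both homogenizations, so Z would divide both. One of [f], [g] has
    the full degree d > 0, and its homogenization has a nonzero form of degree d at Z = 0. *)
Lemma ZZ_dvd_pencil f g (l m l' m' : C) : ~ const_ratio f g -> g != 0 ->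
  l * m' != l' * m -> dvdr ZZ (pencil f g l m) -> ~ dvdr ZZ (pencil f g l' m').
Proof.
move=> nc g0 det h h'; pose d := maxn (tdeg f) (tdeg g).
have c0 : l' * m - l * m' != 0 by rewrite subr_eq0 eq_sym.
have c3M a b : cst3 (a * b : C) = cst3 a * cst3 b by rewrite /cst3 !polyCM.
have c3B a b : cst3 (a - b : C) = cst3 a - cst3 b by rewrite /cst3 !polyCB.
have nz (p : T) : dvdr ZZ (cst3 (l' * m - l * m') * p) -> dvdr ZZ p.
  apply: (primer_dvd_mul ZZ_primer); apply: (primer_ndvd_unit ZZ_primer).
  by rewrite /cst3 !unit_polyC // unitfE.
have hf : dvdr ZZ (homog d f).
  apply: nz; rewrite c3B !c3M.
  have -> : (cst3 l' * cst3 m - cst3 l * cst3 m') * homog d f =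
      cst3 m * pencil f g l' m' - cst3 m' * pencil f g l m by rewrite /pencil -/d; ring.
  by apply: dvdr_sub; apply: dvdr_mull.
have hg : dvdr ZZ (homog d g).
  apply: nz; rewrite c3B !c3M.
  have -> : (cst3 l' * cst3 m - cst3 l * cst3 m') * homog d g =
      cst3 l * pencil f g l' m' - cst3 l' * pencil f g l m by rewrite /pencil -/d; ring.
  by apply: dvdr_sub; apply: dvdr_mull.
have d0 : (0 < d)%N.
  rewrite lt0n; apply/negP => /eqP; rewrite /d => e; apply: nc.
  have cst p : (tdeg p <= 0)%N -> p = cst2 (coef2 p 0 0).
    move=> hp; apply: poly2P => i j; rewrite {2}/coef2 /cst2 coefC.
    have [e0|h0] := eqVneq (coef2 p i j) 0.
      rewrite e0; case: j e0 => [|j] e0; last by rewrite coef0.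
      by rewrite coefC; case: i e0.
    have := leq_trans (coef2_tdeg h0) hp; rewrite leqn0 addn_eq0 => /andP[/eqP -> /eqP ->].
    by rewrite eqxx coefC.
  have [ef eg] : f = cst2 (coef2 f 0 0) /\ g = cst2 (coef2 g 0 0).
    by split; apply: cst; rewrite -e ?leq_maxl ?leq_maxr.
  exists (coef2 f 0 0 / coef2 g 0 0); rewrite {1}ef {2}eg -cst2M divfK //.
  by apply: contraNneq g0 => e0; rewrite eg e0 cst20.
have [e|e] := leqP (tdeg g) (tdeg f).
  by apply: (ZZ_ndvd_homog d0 _ hf); rewrite /d; apply/esym/maxn_idPl.
by apply: (ZZ_ndvd_homog d0 _ hg); rewrite /d; apply/esym/maxn_idPr/ltnW.
Qed.

End Homogeneous.

(** * Affine factors of a member of the pencil *)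

Section PencilFactors.
Variable C : numClosedFieldType.
Local Notation R := {poly {poly C}}.
Local Notation T := {poly {poly {poly C}}}.

Lemma asboolP (P : Prop) : reflect P (asbool P).
Proof. by rewrite /asbool; case: excluded_middle_informative => h; constructor. Qed.

Lemma factorial3 : factorial T.
Proof. by do 3! apply: poly_factorial; apply: field_factorial. Qed.

(* t lists the dehomogenized irreducible factors; Z is lost, as it becomes 1, and the boolean
   accounts for it. *)
Lemma pencil_factors (f g : R) (l m : C) n : pencil f g l m != 0 ->
  nfactors (pencil f g l m) n -> exists t : seq R,
  [/\ forall q, q \in t -> primer q /\ dvdr q (cst2 l * f - cst2 m * g),
      forall j k, (j < size t)%N -> (k < size t)%N -> j != k -> ~ dvdr (nth 0 t j) (nth 0 t k) &
      (n.-1 <= (size t).-1 + asbool (dvdr (ZZ C) (pencil f g l m)))%N].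
Proof.
set P := pencil f g l m => P0 [s [szs hs sneq _]].
have hP : homogeneous3 P := homogeneous3_pencil f g l m.
have sP Q : Q \in s -> [/\ primer Q, dvdr Q P & homogeneous3 Q].
  move=> /(nthP 0)[i hi <-]; rewrite szs in hi; have [iQ dQ] := hs i hi.
  by split=> //; [apply: irr_primer factorial3 _|apply: homogeneous3_dvd hP dQ].
pose r (Q Q' : T) := ~~ asbool (assoc3 Q Q').
have pr : pairwise r s.
  apply/(pairwiseP 0) => i j hi hj hij; apply/asboolP.
  apply: sneq; rewrite -?szs // => e; by rewrite e ltnn in hij.
pose z (Q : T) := asbool (dvdr Q (ZZ C)).
pose s1 := [seq Q <- s | ~~ z Q]; pose s2 := [seq Q <- s | z Q].
have sz12 : (size s1 + size s2 = n)%N by rewrite addnC !size_filter count_predC.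
have dZ Q : Q \in s2 -> dvdr (ZZ C) Q.
  rewrite mem_filter => /andP[/asboolP h /sP[pQ _ _]].
  by apply: primer_dvd_irr h => //; apply: primer_irr; apply: ZZ_primer.
(* A prime that divides Z is associate to Z, and the listed factors are pairwise non-associate. *)
have sz2 : (size s2 <= asbool (dvdr (ZZ C) P))%N.
  case e2 : s2 => [//|Q [|Q' s3]].
    have Qs : Q \in s2 by rewrite e2 mem_head.
    case: asboolP => // h; case: h.
    apply: dvdr_trans (dZ _ Qs) _; move: Qs; rewrite mem_filter => /andP[_ /sP[]] //.
  have : pairwise r s2 by apply: pairwise_filter.
  rewrite e2 /= => /andP[/andP[/asboolP h _] _].
  have Qs : Q \in s2 by rewrite e2 mem_head.
  have Qs' : Q' \in s2 by rewrite e2 !in_cons eqxx orbT.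
  have zd Q0 : Q0 \in s2 -> dvdr Q0 (ZZ C) by rewrite mem_filter => /andP[/asboolP].
  by case: h; split; [apply: dvdr_trans (zd _ Qs) (dZ _ Qs')|apply: dvdr_trans (zd _ Qs') (dZ _ Qs)].
have s1P Q : Q \in s1 -> [/\ primer Q, dvdr Q P, homogeneous3 Q & ~ dvdr Q (ZZ C)].
  by rewrite mem_filter => /andP[/asboolP h /sP[]].
exists [seq Q.[1] | Q <- s1]; split; rewrite ?size_map.
- move=> _ /mapP[Q /s1P[pQ dQ hQ nQ] ->]; split; first exact: dehomog_primer.
  by case: dQ => S eS; exists S.[1]; rewrite -hornerM -eS horner_pencil.
- move=> j k hj hk jk; rewrite !(nth_map 0) //.
  have [pj _ hoj nj] := s1P _ (mem_nth 0 hj); have [pk _ hok _] := s1P _ (mem_nth 0 hk).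
  move=> /(dehomog_dvd pj nj hoj hok) d1.
  have d2 := primer_dvd_irr pj (primer_irr pk) d1.
  have /(pairwiseP 0) h : pairwise r s1 by apply: pairwise_filter.
  case: (ltngtP j k) jk => // jk _.
    by have /asboolP := h j k hj hk jk; apply.
  by have /asboolP := h k j hk hj jk; apply.
- by move: sz12 sz2; move: (size s1) (size s2) (nat_of_bool _) => a b c; clear; lia.
Qed.

End PencilFactors.

(** * Summation over the spectrum *)

Lemma sum_bool_le1 (I : finType) (z : I -> bool) :
  (forall i j, z i -> z j -> i = j) -> (\sum_i z i <= 1)%N.
Proof.
move=> h; have [/existsP[i zi]|/existsPn n] := boolP [exists i, z i]; last first.
  by rewrite big1 // => i _; rewrite (negPf (n i)).
rewrite (bigD1 i) //= zi big1 // => j ji; case zj : (z j) => //.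
by rewrite (h _ _ zi zj) eqxx in ji.
Qed.

(** The sum over the spectrum is bounded through its finite partial sums, [L] being a list of
    distinct remarkable values. Generic means outside the zero set of the nonzero polynomial
    [Delta], chosen before [L]. *)
Theorem mainTheorem1 (C : numClosedFieldType) (k : nat)
    (A B f g : {poly {poly C}}) :
  coprime2 A B -> (tdeg A <= k)%N -> (tdeg B <= k)%N ->
  g != 0 -> coprime2 f g -> ~ const_ratio f g -> ~ decomposable f g ->
  g * derivation A B f - f * derivation A B g = 0 ->
  exists2 Delta : {poly {poly C}}, Delta != 0 &
    forall x y : C, (Delta.[y%:P]).[x] != 0 ->
    forall (L : seq (C * C)) (ns : seq nat),
      size ns = size L ->
      (forall i, (i < size L)%N ->
         [/\ nth (0, 0) L i != (0, 0),
             reducible3 (pencil f g (nth (0, 0) L i).1 (nth (0, 0) L i).2) &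
             nfactors (pencil f g (nth (0, 0) L i).1 (nth (0, 0) L i).2)
                      (nth 0%N ns i)]) ->
      (forall i j, (i < size L)%N -> (j < size L)%N -> i <> j ->
         proj_neq (nth (0, 0) L i) (nth (0, 0) L j)) ->
      (\sum_(i < size L) (nth 0%N ns i).-1 < newtonB A B x y + 2)%N.
Proof.
move=> cop _ _ g0 copfg nc ndec fg0.
have AB : (A != 0) || (B != 0).
  rewrite -negb_and; apply/negP => /andP[/eqP A0 /eqP B0].
  have [] := cop 'X; rewrite ?A0 ?B0; try exact: dvdr0.
  move=> c _ /(congr1 (fun p : {poly {poly C}} => size p)).
  by rewrite size_polyX /cst2 size_polyC; case: eqP.
have fg : first_int (derivation A B) f g by apply/eqP; rewrite -subr_eq0 fg0.
have [Delta D0 hDelta] := lgeneric_exists A B; exists Delta => // x y /hDelta gen.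
move=> L ns szns hL hproj.
pose l i := (nth (0, 0) L i).1; pose m i := (nth (0, 0) L i).2.
have ht i : exists t : seq {poly {poly C}}, (i < size L)%N ->
  [/\ forall q, q \in t -> primer q /\ dvdr q (cst2 (l i) * f - cst2 (m i) * g),
      forall j k, (j < size t)%N -> (k < size t)%N -> j != k -> ~ dvdr (nth 0 t j) (nth 0 t k) &
      ((nth 0%N ns i).-1 <= (size t).-1 + asbool (dvdr (ZZ C) (pencil f g (l i) (m i))))%N].
  have [hi|hi] := classic (i < size L)%N; last by exists [::].
  by have [_ [P0 _ _] /(pencil_factors P0)[t ht]] := hL i hi; exists t.
pose t i := proj1_sig (constructive_indefinite_description _ (ht i)).
have tP (i : 'I_(size L)) : [/\ forall q, q \in t i -> primer q /\ dvdr q (cst2 (l i) * f - cst2 (m i) * g),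
      forall j k, (j < size (t i))%N -> (k < size (t i))%N -> j != k -> ~ dvdr (nth 0 (t i) j) (nth 0 (t i) k) &
      ((nth 0%N ns i).-1 <= (size (t i)).-1 + asbool (dvdr (ZZ C) (pencil f g (l i) (m i))))%N].
  by rewrite /t; case: constructive_indefinite_description => t' h; apply: (h (ltn_ord i)).
have det (i i' : 'I_(size L)) : i != i' -> l i * m i' != l i' * m i.
  move=> ii; apply: hproj => // /val_inj e; by rewrite e eqxx in ii.
(* A pair [(i, j)] stands for the kept factor of index [j.+1] in member [i]; the factor of index 0
   is the omitted one. *)
pose T := {i : 'I_(size L) & 'I_((size (t i)).-1)}.
have cardT : #|{: T}| = (\sum_(i < size L) (size (t i)).-1)%N.
  by rewrite card_tagged sumnE big_map big_enum /=; apply: eq_bigr => i _; rewrite card_ord.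
have sz (x' : T) : ((tagged x').+1 < size (t (tag x')))%N.
  by move: (ltn_ord (tagged x')); lia.
have sep (i i' : 'I_(size L)) j j' : (j < size (t i))%N -> (j' < size (t i'))%N ->
    (i != i') || (j != j') -> ~ dvdr (nth 0 (t i) j) (nth 0 (t i') j').
  have [e|ii] := eqVneq i i'.
    by rewrite -e => hj hj' /= jj; have [_ h _] := tP i; apply: h.
  move=> hj hj' _ h.
  have [/(_ _ (mem_nth 0 hj))[pq qp] _ _] := tP i.
  have [/(_ _ (mem_nth 0 hj'))[_ qp'] _ _] := tP i'.
  exact: (pencil_prime copfg pq (det _ _ ii) qp (dvdr_trans h qp')).
have hcount : (#|{: T}| <= newtonB A B x y)%N.
  pose e (i : 'I_#|{: T}|) : T := enum_val i.
  apply: (@cofactor_count C A B f g x y #|{: T}|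
    (fun i => nth 0 (t (tag (e i))) (tagged (e i)).+1) (fun i => nth 0 (t (tag (e i))) 0%N)
    (fun i => l (tag (e i))) (fun i => m (tag (e i)))) => //.
  - move=> i; have [h _ _] := hL (tag (e i)) (ltn_ord _); move: h.
    by rewrite /l /m; case: (nth _ _ _) => a b /=; rewrite xpair_eqE negb_and.
  - by move=> i; have [h _ _] := tP (tag (e i)); apply: h; apply: mem_nth.
  - by move=> i; have [h _ _] := tP (tag (e i)); apply: h; apply: mem_nth; apply: leq_ltn_trans (sz _).
  - move=> i j ij; apply: sep => //; rewrite -negb_and eqSS; apply: contra ij => /andP[/eqP h1 /eqP h2].
    apply/eqP/enum_val_inj; rewrite -/(e i) -/(e j).
    case: (e i) (e j) h1 h2 => [i1 j1] [i2 j2] /= h1; subst i2 => h2.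
    by rewrite (ord_inj h2).
  - by move=> i j; apply: sep; rewrite ?orbT //; apply: leq_ltn_trans (sz _).
pose z (i : 'I_(size L)) := asbool (dvdr (ZZ C) (pencil f g (l i) (m i))).
have hz : (\sum_i z i <= 1)%N.
  apply: sum_bool_le1 => i j /asboolP zi /asboolP zj; apply/eqP/contraT => ij.
  by case: (ZZ_dvd_pencil nc g0 (det _ _ ij) zi zj).
have : (\sum_(i < size L) (nth 0%N ns i).-1 <= \sum_(i < size L) ((size (t i)).-1 + z i))%N.
  by apply: leq_sum => i _; have [_ _] := tP i.
rewrite big_split /= -cardT => h.
(* The kept factors number at most [newtonB], and Z adds at most one over all members. *)
rewrite addn2 ltnS; apply: leq_trans h _; rewrite -addn1; exact: leq_add.
Qed.
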